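(* Let $F\subset[0,1]^d$ be a self-affine sponge (in the setting described in the context) satisfying the very strong SPPC, and let $\nu_{\mathbf p}$ be the self-affine measure associated with a probability vector $\mathbf p=(p(i))_{i\in\mathcal I}$ with strictly positive entries. Then \[ \max_{\sigma\in\mathcal B}\overline S(\mathbf p,\sigma)\le \dim_{\mathrm A}\nu_{\mathbf p}\le \max_{\sigma\in\mathcal A}\overline S(\mathbf p,\sigma) \quad\text{and}\quad \min_{\sigma\in\mathcal A}\underline S(\mathbf p,\sigma)\le \dim_{\mathrm L}\nu_{\mathbf p}\le \min_{\sigma\in\mathcal B}\underline S(\mathbf p,\sigma), \] where \[ \overline S(\mathbf p,\sigma)=\sum_{n=1}^d\max_{i\in\mathcal I_n^\sigma}\frac{\log P^\sigma_{n-1}(i)}{\log\lambda_i^{(\sigma_n)}},\qquad \underline S(\mathbf p,\sigma)=\sum_{n=1}^d\min_{i\in\mathcal I_n^\sigma}\frac{\log P^\sigma_{n-1}(i)}{\log\lambda_i^{(\sigma_n)}}. \] In particular, for the $\sigma$-ordered coordinate-wise natural measure $\mathbf q^\sigma$, \[ \overline S(\mathbf q^\sigma,\sigma)=s_0^\sigma(\emptyset)+\sum_{n=1}^{d-1}\max_{i\in\mathcal I_n^\sigma}s_n^\sigma(i),\qquad \underline S(\mathbf q^\sigma,\sigma)=s_0^\sigma(\emptyset)+\sum_{n=1}^{d-1}\min_{i\in\mathcal I_n^\sigma}s_n^\sigma(i). \]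
   Context: Setting: $d\ge1$, $\mathcal I=\{1,\dots,N\}$, and for $i\in\mathcal I$, $f_i(x)=A_ix+t_i$ on $\mathbb R^d$ with $A_i=\mathrm{diag}(\lambda_i^{(1)},\dots,\lambda_i^{(d)})$, all $\lambda_i^{(n)}\in(0,1)$, $t_i\in\mathbb R^d$. Assume $f_i([0,1]^d)\subset[0,1]^d$ for all $i$, there are no $i\ne j$ with $f_i=f_j$ on $[0,1]^d$, and every pair of coordinates is distinguishable: for all $m\neq n$ there is $i$ with $\lambda_i^{(n)}\ne\lambda_i^{(m)}$. $F$ is the attractor: the unique nonempty compact set with $F=\bigcup_i f_i(F)$. Let $\Sigma=\mathcal I^{\mathbb N}$, $\pi(\mathbf i)=\lim_k f_{i_1}\circ\cdots\circ f_{i_k}(0)$, $\mu_{\mathbf p}=\mathbf p^{\mathbb N}$ the Bernoulli measure and $\nu_{\mathbf p}=\mu_{\mathbf p}\circ\pi^{-1}$. Dimensions of a compactly supported Borel probability measure $\nu$: $\dim_{\mathrm A}\nu$ is the infimum of $s\ge0$ for which there is $C>0$ with $\nu(B(x,R))/\nu(B(x,r))\le C(R/r)^s$ for all $x\in\mathrm{supp}\,\nu$ and $0<r<R<|\mathrm{supp}\,\nu|$; $\dim_{\mathrm L}\nu$ is the supremum of $s\ge0$ for which there is $C>0$ with $\nu(B(x,R))/\nu(B(x,r))\ge C(R/r)^s$ for all such $x,r,R$ (and $\dim_{\mathrm L}\nu=0$ if $|\mathrm{supp}\,\nu|=0$). Stopping: for $\mathbf i\in\Sigma$, $r>0$, $1\le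 n\le d$, $L_{\mathbf i}(r,n)$ is the unique integer with $\prod_{\ell=1}^{L_{\mathbf i}(r,n)}\lambda_{i_\ell}^{(n)}\le r<\prod_{\ell=1}^{L_{\mathbf i}(r,n)-1}\lambda_{i_\ell}^{(n)}$. For a permutation $\sigma=(\sigma_1,\dots,\sigma_d)$ of $\{1,\dots,d\}$ ($\sigma\in\mathcal S_d$): $\mathbf i$ determines a strictly $\sigma$-ordered cylinder at scale $r$ if, writing $L=L_{\mathbf i}(r,\sigma_d)$, $\prod_{\ell=1}^{L}\lambda_{i_\ell}^{(\sigma_d)}<\prod_{\ell=1}^{L}\lambda_{i_\ell}^{(\sigma_{d-1})}<\dots<\prod_{\ell=1}^{L}\lambda_{i_\ell}^{(\sigma_1)}$. $\mathbf i$ determines a $\sigma$-ordered cube at scale $r$ if $L_{\mathbf i}(r,\sigma_d)\le L_{\mathbf i}(r,\sigma_{d-1})\le\dots\le L_{\mathbf i}(r,\sigma_1)$, where ties are resolved by the rule: if coordinates $k<m$ have $L_{\mathbf i}(r,k)=L_{\mathbf i}(r,m)$, then $k$ precedes $m$ in $\sigma$ iff $\prod_{\ell=1}^{L_{\mathbf i}(r,k)}\lambda_{i_\ell}^{(k)}\ge\prod_{\ell=1}^{L_{\mathbf i}(r,k)}\lambda_{i_\ell}^{(m)}$. $\mathcal A$ is the set of $\sigma\in\mathcal S_d$ such that some $\mathbf i\in\Sigma$, $r>0$ determine a $\sigma$-ordered cube at scale $r$; $\mathcal B$ is the set of $\sigma$ such that some $\mathbf i,r$ determine a strictly $\sigma$-ordered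 cylinder at scale $r$. Projections: $E_n^\sigma$ is the span of the coordinate axes $\sigma_1,\dots,\sigma_n$ and $\Pi_n^\sigma$ the orthogonal projection onto it. $f_i,f_j$ overlap exactly on $E_n^\sigma$ if $\Pi_n^\sigma f_i(x)=\Pi_n^\sigma f_j(x)$ for all $x\in[0,1]^d$. SPPC: for every $\sigma\in\mathcal A$, $1\le n\le d$, $i,j\in\mathcal I$, either $f_i,f_j$ overlap exactly on $E_n^\sigma$ or $\Pi_n^\sigma(f_i((0,1)^d))\cap\Pi_n^\sigma(f_j((0,1)^d))=\emptyset$. Very strong SPPC: the same with $(0,1)^d$ replaced by $[0,1]^d$. Index sets: for $\sigma\in\mathcal S_d$ and $1\le n\le d-1$, $\mathcal I_n^\sigma$ is the set of $j\in\mathcal I$ for which there is no $i<j$ such that $f_i,f_j$ overlap exactly on $E_n^\sigma$; $\mathcal I_d^\sigma=\mathcal I$; $\mathcal I_0^\sigma=\{\emptyset\}$. For $j\in\mathcal I$, $\Pi_n^\sigma j$ is the unique $i\in\mathcal I_n^\sigma$ such that $f_i,f_j$ overlap exactly on $E_n^\sigma$ ($\Pi_d^\sigma$ is the identity, $\Pi_0^\sigma j=\emptyset$). Define $p_n^\sigma(i)=\sum_{j\in\mathcal I:\Pi_n^\sigma j=i}p(j)$ for $i\in\mathcal I_n^\sigma$, $1\le n\le d$, and $p_0^\sigma(\emptyset)=1$; for $1\le n\le d$ and $i\in\mathcal I_n^\sigma$, $P^\sigma_{n-1}(i)=p_n^\sigma(i)/p_{n-1}^\sigma(\Pi_{n-1}^\sigma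 i)$. Natural measure: for $0\le n\le d-1$ and $i\in\mathcal I_n^\sigma$, $s_n^\sigma(i)$ is the unique number with $\sum_{j\in\mathcal I_{n+1}^\sigma:\,\Pi_n^\sigma j=i}\big(\lambda_j^{(\sigma_{n+1})}\big)^{s_n^\sigma(i)}=1$. The $\sigma$-ordered coordinate-wise natural measure is $\mathbf q^\sigma=(q^\sigma(i))_{i\in\mathcal I}$, $q^\sigma(i)=\prod_{n=1}^d\big(\lambda^{(\sigma_n)}_{\Pi_n^\sigma i}\big)^{s_{n-1}^\sigma(\Pi_{n-1}^\sigma i)}$. *)

(* Defs.v *)
From HB Require Import structures.
From mathcomp Require Import all_boot all_order all_algebra all_fingroup.
From mathcomp Require Import all_classical all_reals all_analysis.

Set Implicit Arguments.
Unset Strict Implicit.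
Unset Printing Implicit Defensive.

Import Order.TTheory GRing.Theory Num.Theory numFieldNormedType.Exports.
Local Open Scope classical_set_scope.
Local Open Scope ring_scope.

Definition Sigma (N : nat) := nat -> 'I_N.+1.
HB.instance Definition _ N := Choice.on (Sigma N).
HB.instance Definition _ N := isPointed.Build (Sigma N) (fun _ => ord0).

(* cylinder [w_1 ... w_n] (0-based: w 0, ..., w (n-1)) *)
Definition cyl (N : nat) (w : Sigma N) (n : nat) : set (Sigma N) :=
  [set v | forall k, (k < n)%N -> v k = w k].

Definition cylinders (N : nat) : set (set (Sigma N)) :=
  [set A | exists w n, A = cyl w n].

Definition SigmaM (N : nat) := g_sigma_algebraType (@cylinders N).

(* mu is the Bernoulli measure p^N : its value on each cylinder is the
   product of the weights (this determines it uniquely). *)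
Definition is_bernoulli (R : realType) (N : nat) (p : 'I_N.+1 -> R)
  (mu : set (SigmaM N) -> \bar R) : Prop :=
  forall (w : Sigma N) (n : nat), mu (cyl w n) = (\prod_(k < n) p (w k))%:E.

Section Sponge.
Variables (R : realType) (d N : nat).
Variables (lam t : 'I_N.+1 -> 'I_d -> R).

Local Notation I := 'I_N.+1.
Local Notation pt := ('I_d -> R).

Definition ifs_map (i : I) (x : pt) : pt := fun n => lam i n * x n + t i n.

Definition unit_cube : set pt := [set x | forall n, 0 <= x n <= 1].

Fixpoint compw (w : Sigma N) (k : nat) (x : pt) : pt :=
  match k with
  | 0 => x
  | k.+1 => compw w k (ifs_map (w k) x)
  end.

(* the coding map pi(w) = lim_k f_{w_1} o ... o f_{w_k}(0); the limit in R^d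
   is taken coordinatewise (R^d carries the product topology). *)
Definition coding (w : Sigma N) : pt :=
  fun n => limn (fun k => compw w k (fun _ => 0) n).

Definition edist (x y : pt) : R := Num.sqrt (\sum_(n < d) (x n - y n) ^+ 2).
Definition cball (x : pt) (r : R) : set pt := [set y | edist x y <= r].
Definition oball (x : pt) (r : R) : set pt := [set y | edist x y < r].

Definition diam (S : set pt) : R :=
  sup [set edist xy.1 xy.2 | xy in S `*` S].

Definition nu (mu : set (SigmaM N) -> \bar R) (B : set pt) : R :=
  fine (mu (coding @^-1` B)).

Definition supp (mu : set (SigmaM N) -> \bar R) : set pt :=
  [set x | forall r, 0 < r -> 0 < nu mu (oball x r)].

Definition assouad_dim (mu : set (SigmaM N) -> \bar R) : \bar R :=
  ereal_inf [set s%:E | s in [set s : R | 0 <= s /\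
    exists C : R, 0 < C /\
      forall (x : pt) (r Rr : R), supp mu x -> 0 < r -> r < Rr ->
        Rr < diam (supp mu) ->
        nu mu (cball x Rr) / nu mu (cball x r) <= C * powR (Rr / r) s]].

Definition lower_dim (mu : set (SigmaM N) -> \bar R) : \bar R :=
  if diam (supp mu) == 0 then 0%E else
  ereal_sup [set s%:E | s in [set s : R | 0 <= s /\
    exists C : R, 0 < C /\
      forall (x : pt) (r Rr : R), supp mu x -> 0 < r -> r < Rr ->
        Rr < diam (supp mu) ->
        nu mu (cball x Rr) / nu mu (cball x r) >= C * powR (Rr / r) s]].

Definition prodL (w : Sigma N) (n : 'I_d) (L : nat) : R :=
  \prod_(l < L) lam (w l) n.

Definition is_stop (w : Sigma N) (r : R) (n : 'I_d) (L : nat) : Prop :=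
  prodL w n L <= r < prodL w n L.-1.

(* sigma_{a+1} (paper, 1-based) = sigma a (0-based); "k precedes m in sigma"
   means sigma^-1 k < sigma^-1 m. *)
Definition ordered_cube (w : Sigma N) (r : R) (sigma : 'S_d) : Prop :=
  exists Ls : 'I_d -> nat,
    (forall n, is_stop w r n (Ls n)) /\
    (forall a b : 'I_d, (a < b)%N -> (Ls (sigma b) <= Ls (sigma a))%N) /\
    (forall k m : 'I_d, (k < m)%N -> Ls k = Ls m ->
       ((((sigma^-1)%g k) < ((sigma^-1)%g m))%N <->
        prodL w m (Ls k) <= prodL w k (Ls k))).

Definition strict_ordered_cyl (w : Sigma N) (r : R) (sigma : 'S_d) : Prop :=
  exists (k : 'I_d) (L : nat), nat_of_ord k = d.-1 /\
    is_stop w r (sigma k) L /\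
    (forall a b : 'I_d, (a < b)%N -> prodL w (sigma b) L < prodL w (sigma a) L).

Definition inA (sigma : 'S_d) : Prop :=
  exists (w : Sigma N) (r : R), 0 < r /\ ordered_cube w r sigma.

Definition inB (sigma : 'S_d) : Prop :=
  exists (w : Sigma N) (r : R), 0 < r /\ strict_ordered_cyl w r sigma.

Definition proj (sigma : 'S_d) (n : nat) (x : pt) : pt :=
  fun k => if (((sigma^-1)%g k) < n)%N then x k else 0.

Definition overlap (sigma : 'S_d) (n : nat) (i j : I) : Prop :=
  forall x, unit_cube x -> proj sigma n (ifs_map i x) = proj sigma n (ifs_map j x).

Definition very_strong_SPPC : Prop :=
  forall sigma : 'S_d, inA sigma ->
  forall n : nat, (1 <= n <= d)%N -> forall i j : I,
    overlap sigma n i j \/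
    [set proj sigma n (ifs_map i x) | x in unit_cube] `&`
    [set proj sigma n (ifs_map j x) | x in unit_cube] = set0.

Definition Iset (sigma : 'S_d) (n : nat) (j : I) : Prop :=
  n = d \/ ~ (exists i : I, (i < j)%N /\ overlap sigma n i j).

(* Pi_n^sigma j, for 1 <= n <= d : the unique i in I_n^sigma overlapping j *)
Definition projidx (sigma : 'S_d) (n : nat) (j : I) : I :=
  if n == d then j else xget j [set i | Iset sigma n i /\ overlap sigma n i j].

Definition pmass (p : I -> R) (sigma : 'S_d) (n : nat) (i : I) : R :=
  if n == 0%N then 1 else \sum_(j : I | projidx sigma n j == i) p j.

(* P_{n-1}^sigma(i), for 1 <= n <= d *)
Definition Pcond (p : I -> R) (sigma : 'S_d) (n : nat) (i : I) : R :=
  pmass p sigma n i / pmass p sigma n.-1 (projidx sigma n.-1 i).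

(* log P_{n}^sigma(i) / log lambda_i^{(sigma_{n+1})}  (n 0-based) *)
Definition ratio (p : I -> R) (sigma : 'S_d) (n : 'I_d) (i : I) : R :=
  ln (Pcond p sigma n.+1 i) / ln (lam i (sigma n)).

Definition Sbar (p : I -> R) (sigma : 'S_d) : \bar R :=
  \sum_(n < d) \big[maxe/-oo%E]_(i : I | `[< Iset sigma n.+1 i >])
                  (ratio p sigma n i)%:E.

Definition Sunder (p : I -> R) (sigma : 'S_d) : \bar R :=
  \sum_(n < d) \big[mine/+oo%E]_(i : I | `[< Iset sigma n.+1 i >])
                  (ratio p sigma n i)%:E.

(* s_n^sigma(i) for 0 <= n <= d-1 (n 0-based as an ordinal);
   i = None stands for the empty index (only for n = 0), Some i for
   i in I_n^sigma (n >= 1). *)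
Definition sexp (sigma : 'S_d) (n : 'I_d) (i : option I) : R :=
  xget 0 [set s : R |
    \sum_(j : I | `[< Iset sigma n.+1 j >] &&
                  match i with None => true | Some i => projidx sigma n j == i end)
       powR (lam j (sigma n)) s = 1].

Definition qnat (sigma : 'S_d) (i : I) : R :=
  \prod_(n < d) powR (lam (projidx sigma n.+1 i) (sigma n))
                     (sexp sigma n (if nat_of_ord n == 0%N then None
                                    else Some (projidx sigma n i))).

End Sponge.

(* Main.v *)
Require Import Defs.
From HB Require Import structures.
From mathcomp Require Import all_boot all_order all_algebra all_fingroup.
From mathcomp Require Import all_classical all_reals all_analysis.
From mathcomp Require Import zify ring lra.
Import Order.TTheory GRing.Theory Num.Theory numFieldNormedType.Exports.
Local Open Scope classical_set_scope.
Local Open Scope ring_scope.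

Set Implicit Arguments.
Unset Strict Implicit.
Unset Printing Implicit Defensive.

(** The idea is to compare balls with approximate cubes.  In coordinate [k] an
    approximate cube of size [r] around the coding of [w] prescribes the first
    [L_w(r, k)] letters up to exact overlap in that coordinate.  Its image lies
    in a box of side [r], and the very strong SPPC supplies a [delta] such that
    the ball of radius [delta * r] meets the attractor only inside it.  If [s]
    orders the stopping times, then minus the logarithm of its Bernoulli mass is
    the sum over [n] of the costs [- ln P_{n-1}] of the first [L_w(r, s_n)]
    letters, and each cost is at most (at least) the [n]-th term of [Sbar]
    ([Sunder]) times the logarithmic contraction of the letter.

    Between two scales with the same ordering this gives the bounds over the
    class A at once.  The ordering may change infinitely often, but jumping to
    the last scale that carries the current ordering loses only a bounded factor
    per permutation.  For the bounds over the class B, a word whose contraction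
    ratios are strictly ordered by [s] is repeated so often that the places
    where the different coordinates cross a given range of scales become
    disjoint; there one inserts blocks of the extremal letters. *)

(** * Finite families, labelled sequences and stopping times *)

(** Balls know nothing of orderings, while the mass formula needs one. An ordering [s] enters only
    through one fact: at every position [l] the coordinates still prescribed form an initial segment
    of [s]. This serves twice. It places the first disagreement of two words in a subspace $E_n^s$
    with [s] in class A, where the very strong SPPC gives disjointness; and it turns the factor of
    the mass at [l] into a telescoping product of conditional masses. Neighbouring scales with
    different orderings share no such formula, but a crude count of the positions whose constraint
    changes is enough there.

    In the bounds over class B the logarithm [tau] of the ratio of the two scales is fixed before
    the scales themselves: keeping the windows apart requires [r'] to be small depending on [tau],
    whereas the error in the mass must not depend on [tau]. Dividing by [tau] and letting it grow
    then leaves exactly the sum of the ratios. *)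

Lemma fin_family_ubound (R : realType) (T : finType) (f : T -> R) :
  exists2 M : R, 0 < M & forall x, f x <= M.
Proof.
exists (1 + \sum_x `|f x|); first by rewrite ltr_pwDl// sumr_ge0.
move=> x; rewrite (bigD1 x)//= addrCA (le_trans (ler_norm _))// lerDl.
by rewrite addr_ge0// sumr_ge0.
Qed.

Lemma fin_family_lbound (R : realType) (T : finType) (f : T -> R) :
  (forall x, 0 < f x) -> exists2 m : R, 0 < m & forall x, m <= f x.
Proof.
move=> f0; have [M M0 fM] := fin_family_ubound (fun x => (f x)^-1).
exists M^-1; rewrite ?invr_gt0// => x.
by rewrite -(invrK (f x)) lef_pV2 ?posrE ?invr_gt0.
Qed.

Lemma ln_prod (R : realType) (T : Type) (s : seq T) (P : pred T) (f : T -> R) :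
  (forall i, 0 < f i) ->
  ln (\prod_(i <- s | P i) f i) = \sum_(i <- s | P i) ln (f i).
Proof.
move=> f0; rewrite -[RHS]expRK expR_sum; congr (ln _).
by apply: eq_bigr => i _; rewrite lnK ?posrE.
Qed.

(* A sequence whose increments are controlled between any two times carrying
   the same label is controlled globally: jump from the current time to the
   last occurrence of its label, and that label is never met again. *)
Lemma labelled_growth (R : realType) (T : finType) (lab : nat -> T)
    (g : nat -> R) (S K : R) : 0 <= K ->
  (forall a b, (a <= b)%N -> lab a = lab b -> g b - g a <= S * (b - a)%:R + K) ->
  (forall a, g a.+1 - g a <= S + K) ->
  forall a b, (a <= b)%N -> g b - g a <= S * (b - a)%:R + 2 * K * #|T|%:R.
Proof.
move=> K0 same adj.
(* Induction on the number of labels available in [[a, b]]. Each label costs [K] for the jump to its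
   last occurrence and [K] for the single step beyond it, hence [2 * K]. *)
have main : forall (n : nat) (X : {set T}), #|X| = n ->
    forall a b, (a <= b)%N ->
    (forall j, (a <= j <= b)%N -> lab j \in X) ->
    g b - g a <= S * (b - a)%:R + 2 * K * n%:R.
  elim=> [|n IH] X cX a b ab inX.
    have := inX a; rewrite leqnn ab => /(_ isT).
    by move/eqP: cX; rewrite cards_eq0 => /eqP ->; rewrite inE.
  have Pa : exists j, (a <= j <= b)%N && (lab j == lab a).
    by exists a; rewrite leqnn ab eqxx.
  have Pub : forall j, (a <= j <= b)%N && (lab j == lab a) -> (j <= b)%N.
    by move=> j /andP[/andP[]].
  case: (ex_maxnP Pa Pub) => c /andP[/andP[ac cb] /eqP lc] cmax.
  have h1 : g c - g a <= S * (c - a)%:R + K by apply: same.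
  move: cb; rewrite leq_eqVlt => /orP[/eqP cb|cb].
    rewrite cb in h1; apply: (le_trans h1); rewrite lerD2l mulrC.
    have n1 : 1 <= n.+1%:R :> R by rewrite ler1n.
    nra.
  have h2 := adj c.
  have h3 : g b - g c.+1 <= S * (b - c.+1)%:R + 2 * K * n%:R.
    apply: (IH (X :\ lab a)) => //.
      have := cardsD1 (lab a) X; rewrite inX ?leqnn ?(leq_trans ac (ltnW cb))//.
      by rewrite cX => -[->].
    move=> j /andP[cj jb]; rewrite !inE inX ?andbT; last first.
      by rewrite jb andbT (leq_trans ac)// (leq_trans _ cj).
    apply/eqP => lj; have := cmax j; rewrite jb lj eqxx !andbT.
    rewrite (leq_trans ac (leq_trans (leqnSn _) cj)) => /(_ isT).
    by rewrite leqNgt cj.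
  have -> : (b - a = (c - a) + 1 + (b - c.+1))%N by lia.
  rewrite !natrD -[n.+1]addn1 natrD.
  set x := (c - a)%:R in h1 *; set y := (b - c.+1)%:R in h3 *; nra.
move=> a b ab; apply: (main #|T| [set: T]%SET) => //; rewrite ?cardsT//.
Qed.

Lemma exists_sorting_perm (d : nat) (e : rel 'I_d) :
  total e -> transitive e ->
  exists s : 'S_d, forall a b : 'I_d, (a < b)%N -> e (s a) (s b).
Proof.
move=> etot etr; pose s := sort e (enum 'I_d).
have ss : size s = d by rewrite size_sort size_enum_ord.
have us : uniq s by rewrite sort_uniq enum_uniq.
pose f (a : 'I_d) := nth a s a.
have fE (a b : 'I_d) : f a = nth b s a by apply: set_nth_default; rewrite ss.
have finj : injective f.
  move=> a b; rewrite (fE b a) /f => /eqP; rewrite nth_uniq ?ss//.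
  by move=> /eqP/val_inj.
exists (perm finj) => a b ab; rewrite !permE (fE b a).
by apply: (sorted_ltn_nth etr a (sort_sorted etot _)); rewrite ?inE ?ss.
Qed.

(** The additive form of [prodL]: each letter advances by a positive amount bounded above and below,
    and stopping at [r] means reaching the level [- ln r]. *)
Definition height (R : realType) (d N : nat) (lam : 'I_N.+1 -> 'I_d -> R)
    (w : Sigma N) (k : 'I_d) (l : nat) : R :=
  \sum_(m < l) - ln (lam (w m) k).

(* The paper's L_w(r, k) for r < 1, and 0 for r >= 1. *)
Definition stopL (R : realType) (d N : nat) (lam : 'I_N.+1 -> 'I_d -> R)
    (w : Sigma N) (r : R) (k : 'I_d) : nat :=
  xget 0%N [set L | prodL lam w k L <= r /\
                    forall l, (l < L)%N -> r < prodL lam w k l].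

Section Stopping.
Variables (R : realType) (d N : nat) (lam : 'I_N.+1 -> 'I_d -> R).
Hypothesis lam01 : forall i n, 0 < lam i n < 1.
Implicit Types (w : Sigma N) (r : R) (k : 'I_d) (l : nat).

Lemma lam_gt0 i k : 0 < lam i k.
Proof. by case/andP: (lam01 i k). Qed.

Lemma prodLS w k l : prodL lam w k l.+1 = prodL lam w k l * lam (w l) k.
Proof. by rewrite /prodL big_ord_recr. Qed.

Lemma prodL0 w k : prodL lam w k 0 = 1.
Proof. by rewrite /prodL big_ord0. Qed.

Lemma prodL_gt0 w k l : 0 < prodL lam w k l.
Proof. by apply: prodr_gt0 => i _; exact: lam_gt0. Qed.

Lemma heightS w k l : height lam w k l.+1 = height lam w k l - ln (lam (w l) k).
Proof. by rewrite /height big_ord_recr. Qed.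

Lemma height0 w k : height lam w k 0 = 0.
Proof. by rewrite /height big_ord0. Qed.

Lemma heightE w k l : height lam w k l = - ln (prodL lam w k l).
Proof. by rewrite /height /prodL ln_prod ?sumrN// => i; exact: lam_gt0. Qed.

Lemma nln_lam_gt0 i k : 0 < - ln (lam i k).
Proof. by rewrite oppr_gt0 ln_lt0. Qed.

Lemma le_height w k : {homo height lam w k : l m / (l <= m)%N >-> l <= m}.
Proof.
apply: homo_leq => [//|y x z|l]; first exact: le_trans.
by rewrite heightS lerDl ltW ?nln_lam_gt0.
Qed.

Lemma prodL_le w k l m : (l <= m)%N -> prodL lam w k m <= prodL lam w k l.
Proof.
move=> lm; rewrite -ler_ln ?posrE ?prodL_gt0// -lerN2 -!heightE.
exact: le_height.
Qed.

Lemma nln_lam_bounds : exists hmin hmax : R, 0 < hmin /\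
  forall i k, hmin <= - ln (lam i k) <= hmax.
Proof.
have [m m0 hm] := fin_family_lbound
  (f := fun ik : 'I_N.+1 * 'I_d => - ln (lam ik.1 ik.2))
  (fun ik => nln_lam_gt0 _ _).
have [M M0 hM] := fin_family_ubound
  (fun ik : 'I_N.+1 * 'I_d => - ln (lam ik.1 ik.2)).
by exists m, M; split=> // i k; rewrite (hm (i, k)) (hM (i, k)).
Qed.

Lemma height_diff w k l m : (l <= m)%N ->
  height lam w k m - height lam w k l = \sum_(l <= j < m) - ln (lam (w j) k).
Proof.
move=> lm; rewrite /height -!(big_mkord xpredT (fun j => - ln (lam (w j) k))).
by rewrite (big_cat_nat (leq0n l) lm)/= addrAC subrr add0r.
Qed.

Lemma height_diff_ge w k hmin : (forall i k, hmin <= - ln (lam i k)) ->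
  forall l m, (l <= m)%N ->
  hmin * (m - l)%:R <= height lam w k m - height lam w k l.
Proof.
move=> hm l m lm; rewrite height_diff//.
rewrite [leLHS](_ : _ = \sum_(l <= j < m) hmin).
  by apply: ler_sum => j _.
by rewrite sumr_const_nat mulr_natr.
Qed.

Lemma stopLP w r k : 0 < r ->
  prodL lam w k (stopL lam w r k) <= r /\
  forall l, (l < stopL lam w r k)%N -> r < prodL lam w k l.
Proof.
move=> r0; rewrite /stopL.
apply: (xgetPex 0%N (P := [set L | prodL lam w k L <= r /\
                    forall l, (l < L)%N -> r < prodL lam w k l])).
have [hmin [hmax [h0 hh]]] := nln_lam_bounds.
have ex : exists L, prodL lam w k L <= r.
  pose x := - ln r / hmin.
  exists (Num.Def.archi_bound `|x|).
  rewrite -ler_ln ?posrE ?prodL_gt0// -lerN2 -heightE.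
  have := @height_diff_ge w k hmin (fun i k => proj1 (andP (hh i k))) 0
            (Num.Def.archi_bound `|x|) (leq0n _).
  rewrite height0 subr0 subn0; apply: le_trans.
  rewrite mulrC -ler_pdivrMr// ltW// (le_lt_trans (ler_norm _))//.
  exact: archi_boundP.
case: (ex_minnP ex) => L hL Lmin; exists L; split=> // l lL.
by rewrite ltNge; apply/negP => /Lmin; rewrite leqNgt lL.
Qed.

Lemma prodL_stopL w r k : 0 < r -> prodL lam w k (stopL lam w r k) <= r.
Proof. by move=> /(stopLP w k)[]. Qed.

Lemma lt_stopL w r k l : 0 < r ->
  (l < stopL lam w r k)%N = (r < prodL lam w k l).
Proof.
move=> r0; have [h1 h2] := stopLP w k r0; apply/idP/idP; first exact: h2.
move=> h; rewrite ltnNge; apply/negP => /(prodL_le w k) h3.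
by move: (lt_le_trans h (le_trans h3 h1)); rewrite ltxx.
Qed.

Lemma lt_stopL_height w r k l : 0 < r ->
  (l < stopL lam w r k)%N = (height lam w k l < - ln r).
Proof.
by move=> r0; rewrite lt_stopL// heightE ltrN2 ltr_ln ?posrE ?prodL_gt0.
Qed.

Lemma stopL_le_height w r k l : 0 < r ->
  (stopL lam w r k <= l)%N = (- ln r <= height lam w k l).
Proof. by move=> r0; rewrite leqNgt lt_stopL_height// -leNgt. Qed.

Lemma stopL_ge1 w r k : 1 <= r -> stopL lam w r k = 0%N.
Proof.
move=> r1; apply/eqP; rewrite -leqn0 leqNgt lt_stopL ?(lt_le_trans ltr01)//.
by rewrite prodL0 -leNgt.
Qed.

Lemma le_stopL w r s k : 0 < r -> r <= s ->
  (stopL lam w s k <= stopL lam w r k)%N.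
Proof.
move=> r0 rs; have s0 := lt_le_trans r0 rs.
rewrite stopL_le_height// (@le_trans _ _ (- ln r))//.
  by rewrite lerN2 ler_ln.
by rewrite -stopL_le_height.
Qed.

(** The level is overshot by at most one letter. For [r > 1] no letter is read and the upper bound
    may fail. *)
Lemma height_stopL w r k hmax : (forall i k, - ln (lam i k) <= hmax) ->
  0 < r <= 1 ->
  - ln r <= height lam w k (stopL lam w r k) <= - ln r + hmax.
Proof.
move=> hM /andP[r0 r1]; rewrite -stopL_le_height// leqnn/=.
have hm0 : 0 <= hmax by rewrite (le_trans _ (hM ord0 k))// ltW// nln_lam_gt0.
case E : (stopL lam w r k) => [|L].
  by rewrite height0 addr_ge0// oppr_ge0 ln_le0.
rewrite heightS lerD// ltW// -lt_stopL_height// E//.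
Qed.

Lemma stopL_is_stop w r k : 0 < r < 1 -> is_stop lam w r k (stopL lam w r k).
Proof.
move=> /andP[r0 r1]; rewrite /is_stop prodL_stopL//= -lt_stopL//.
by have : (0 < stopL lam w r k)%N; [rewrite lt_stopL ?prodL0 | lia].
Qed.

Lemma ordered_cube_exists w r : 0 < r < 1 -> exists s, ordered_cube lam w r s.
Proof.
move=> r01; pose L := stopL lam w r; pose P k := prodL lam w k (L k).
(* Lexicographic: later stopping first, then longer side, then smaller index. The last clause
   matches the tie rule, where equality favours the smaller coordinate. *)
pose e (k m : 'I_d) := (L m < L k)%N || (L m == L k) &&
   ((P m < P k) || (P m == P k) && (k <= m)%N).
have [||s hs] := @exists_sorting_perm d e.
- move=> k m; rewrite /e; case: (ltngtP (L m) (L k)) => //= _.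
  by case: (ltgtP (P m) (P k)) => //= _; rewrite leq_total.
- move=> k m n; rewrite /e.
  case: (ltngtP (L k) (L m)) => //= h1.
    by case: (ltngtP (L n) (L k)) => //= h2 _; case: (ltngtP (L n) (L m)) => //=; lia.
  rewrite h1; case: (ltngtP (L n) (L m)) => //= h2.
  case: (ltgtP (P k) (P m)) => //= h3.
    case: (ltgtP (P n) (P k)) => //= h4 _.
      by move=> _; rewrite (lt_trans h4 h3).
    by rewrite h4 h3.
  rewrite h3; case: (ltgtP (P n) (P m)) => //= h4.
  by move=> a b; apply: leq_trans a b.
exists s, L; split; first by move=> n; exact: stopL_is_stop.
split=> [a b /hs|k m km Lkm].
  by rewrite /e => /orP[/ltnW //|/andP[/eqP->]].
have [a ka] : exists a, k = s a by exists ((s^-1)%g k); rewrite permKV.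
have [b mb] : exists b, m = s b by exists ((s^-1)%g m); rewrite permKV.
rewrite {1}ka {1}mb !permK.
have -> : prodL lam w m (L k) = P m by rewrite Lkm.
rewrite -[prodL lam w k (L k)]/(P k).
split=> [/hs|h].
  rewrite -ka -mb /e Lkm ltnn eqxx/= => /orP[/ltW//|/andP[/eqP-> //]].
case: (ltngtP a b) => // ab; last first.
  by move: km; rewrite ka mb (val_inj ab) ltnn.
move: (hs _ _ ab); rewrite -ka -mb /e Lkm ltnn eqxx/=.
move=> /orP[|/andP[_]]; first by rewrite ltNge h.
by rewrite leqNgt km.
Qed.

End Stopping.

(** * The coding map and separation of approximate cubes *)

Definition agree (R : realType) (d N : nat) (lam t : 'I_N.+1 -> 'I_d -> R)
    (k : 'I_d) (i j : 'I_N.+1) : bool :=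
  (lam i k == lam j k) && (t i k == t j k).

Definition shiftw (N : nat) (l : nat) (w : Sigma N) : Sigma N :=
  fun m => w (l + m)%N.

(** Coordinate [k] of the image of the origin under the composition of the first [l] maps, as
    [compwE] shows. *)
Definition psum (R : realType) (d N : nat) (lam t : 'I_N.+1 -> 'I_d -> R)
    (w : Sigma N) (k : 'I_d) (l : nat) : R :=
  \sum_(m < l) prodL lam w k m * t (w m) k.

(* The symbolic approximate cube of the paper, described without reference to
   a permutation: in coordinate k only the first Ls k letters are prescribed,
   and only up to exact overlap in that coordinate. *)
Definition acube (R : realType) (d N : nat) (lam t : 'I_N.+1 -> 'I_d -> R)
    (w : Sigma N) (Ls : 'I_d -> nat) : set (Sigma N) :=
  [set v | forall l k, (l < Ls k)%N -> agree lam t k (v l) (w l)].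

(** The ordering condition without its tie rule: masses and separation depend on this monotonicity
    alone, the tie rule only on membership in class A. *)
Definition compat (d : nat) (s : 'S_d) (Ls : 'I_d -> nat) : Prop :=
  forall a b : 'I_d, (a < b)%N -> (Ls (s b) <= Ls (s a))%N.

Section EuclideanDistance.
Variables (R : realType) (d : nat).
Implicit Types x y : 'I_d -> R.

Lemma le_coord_edist x y k : `|x k - y k| <= Defs.edist x y.
Proof.
rewrite /Defs.edist -sqrtr_sqr ler_wsqrtr// (bigD1 k)//= lerDl.
by rewrite sumr_ge0// => i _; rewrite sqr_ge0.
Qed.

Lemma edist_le_sum x y : Defs.edist x y <= \sum_k `|x k - y k|.
Proof.
have s0 : 0 <= \sum_k `|x k - y k| by rewrite sumr_ge0.
rewrite /Defs.edist -[leRHS]ger0_norm// -sqrtr_sqr ler_wsqrtr//.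
rewrite expr2 mulr_suml; apply: ler_sum => k _.
rewrite -[leLHS]ger0_norm ?sqr_ge0// normrX expr2 ler_wpM2l// (bigD1 k)//= lerDl.
by rewrite sumr_ge0.
Qed.

Lemma edist_le_coord x y (e : R) :
  (forall k, `|x k - y k| <= e) -> Defs.edist x y <= d%:R * e.
Proof.
move=> h; apply: (le_trans (edist_le_sum x y)).
rewrite mulr_natl -[X in _ *+ X]card_ord -sumr_const.
by apply: ler_sum => k _.
Qed.

End EuclideanDistance.

(** The prescribed coordinates at position [l] span $E_n^s$ for some [n]. This is the bridge from
    stopping times to the projections in the SPPC and to the masses $p_n^s$. *)
Lemma compat_segment (d : nat) (s : 'S_d) (Ls : 'I_d -> nat) (l : nat) :
  compat s Ls ->
  exists2 n : nat, (n <= d)%N & forall a : 'I_d, (a < n)%N = (l < Ls (s a))%N.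
Proof.
move=> cs.
have ex : exists n, [forall a : 'I_d, (l < Ls (s a))%N ==> (a < n)%N].
  by exists d; apply/forallP => a; rewrite ltn_ord implybT.
case: (ex_minnP ex) => n /forallP hn nmin; exists n.
  by apply: nmin; apply/forallP => a; rewrite ltn_ord implybT.
move=> a; apply/idP/idP; last by have := hn a; move/implyP.
move=> an; case: n hn nmin an => // n hn nmin an.
have : ~~ [forall a : 'I_d, (l < Ls (s a))%N ==> (a < n)%N].
  by apply/negP => /nmin; rewrite ltnn.
rewrite negb_forall => /existsP[b]; rewrite negb_imply => /andP[lb].
rewrite -leqNgt => nb; apply: (leq_trans lb).
have : (a <= b)%N by lia.
rewrite leq_eqVlt => /orP[/eqP/val_inj->//|ab]; exact: cs.
Qed.

Section Coding.
Variables (R : realType) (d N : nat) (lam t : 'I_N.+1 -> 'I_d -> R).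
Hypothesis lam01 : forall i n, 0 < lam i n < 1.
Hypothesis fcube :
  forall i x, unit_cube x -> unit_cube (ifs_map lam t i x).
Implicit Types (v w : Sigma N) (k : 'I_d) (l : nat).

Lemma agree_refl k i : agree lam t k i i.
Proof. by rewrite /agree !eqxx. Qed.

Lemma agree_sym k i j : agree lam t k i j = agree lam t k j i.
Proof. by rewrite /agree eq_sym (eq_sym (t i k)). Qed.

Lemma agree_trans k i j n :
  agree lam t k i j -> agree lam t k j n -> agree lam t k i n.
Proof. by move=> /andP[/eqP h /eqP h']; rewrite /agree h h'. Qed.

(** Testing at the corners with all entries 0 and all entries 1 recovers the translation and the
    ratio, so exact overlap is decided coordinate by coordinate. *)
Lemma overlapP (s : 'S_d) n i j : overlap lam t s n i j <->
  forall k, ((s^-1)%g k < n)%N -> agree lam t k i j.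
Proof.
split=> [ov k kn|ag x _]; last first.
  apply/funext => k; rewrite /Defs.proj; case: ifPn => // /ag /andP[/eqP h1 /eqP h2].
  by rewrite /ifs_map h1 h2.
have u0 : unit_cube (fun _ : 'I_d => 0 : R) by move=> ?; rewrite lexx ler01.
have u1 : unit_cube (fun _ : 'I_d => 1 : R) by move=> ?; rewrite lexx ler01.
have := congr1 (fun f : 'I_d -> R => f k) (ov _ u0).
have := congr1 (fun f : 'I_d -> R => f k) (ov _ u1).
rewrite /Defs.proj /ifs_map kn !mulr0 !add0r !mulr1 => e2 e1.
rewrite /agree e1 eqxx andbT; apply/eqP; move: e2; rewrite e1; exact: addIr.
Qed.

Lemma transl_ge0 i k : 0 <= t i k.
Proof.
have u0 : unit_cube (fun _ : 'I_d => 0 : R) by move=> ?; rewrite lexx ler01.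
by have := @fcube i _ u0 k; rewrite /ifs_map mulr0 add0r => /andP[].
Qed.

Lemma transl_le i k : lam i k + t i k <= 1.
Proof.
have u1 : unit_cube (fun _ : 'I_d => 1 : R) by move=> ?; rewrite lexx ler01.
by have := @fcube i _ u1 k; rewrite /ifs_map mulr1 => /andP[].
Qed.

Lemma compwE w l (x : 'I_d -> R) k :
  compw lam t w l x k = psum lam t w k l + prodL lam w k l * x k.
Proof.
elim: l x => [|l IH] x /=; first by rewrite /psum big_ord0 prodL0 add0r mul1r.
by rewrite IH /psum big_ord_recr/= prodLS /ifs_map; ring.
Qed.

Lemma psumS w k l :
  psum lam t w k l.+1 = psum lam t w k l + prodL lam w k l * t (w l) k.
Proof. by rewrite /psum big_ord_recr. Qed.

(** The left side is the right endpoint of the image of the unit interval in coordinate [k]. This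
    bounds the increasing sequence [psum]. *)
Lemma psum_prodL_le1 w k l : psum lam t w k l + prodL lam w k l <= 1.
Proof.
elim: l => [|l IH]; first by rewrite /psum big_ord0 prodL0 add0r.
rewrite psumS prodLS; have := transl_le (w l) k; have := prodL_gt0 lam01 w k l.
nra.
Qed.

Lemma le_psum w k : {homo psum lam t w k : l m / (l <= m)%N >-> l <= m}.
Proof.
apply: homo_leq => [//|y x z|l]; first exact: le_trans.
by rewrite psumS lerDl mulr_ge0 ?transl_ge0// ltW ?prodL_gt0.
Qed.

Lemma codingE w k : coding lam t w k = limn (psum lam t w k).
Proof.
rewrite /coding; congr (lim (_ @ \oo)); apply/funext => l.
by rewrite compwE mulr0 addr0.
Qed.

Lemma psum_is_cvg w k : cvgn (psum lam t w k).
Proof.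
apply: nondecreasing_is_cvgn; first exact: le_psum.
exists 1 => _ [l _ <-]; apply: le_trans (psum_prodL_le1 w k l).
by rewrite lerDl ltW// prodL_gt0.
Qed.

Lemma coding_ge0 w k : 0 <= coding lam t w k.
Proof.
rewrite codingE; apply: le_trans (nondecreasing_cvgn_le (@le_psum w k) (@psum_is_cvg w k) 0%N).
by rewrite /psum big_ord0.
Qed.

Lemma coding_le1 w k : coding lam t w k <= 1.
Proof.
rewrite codingE; apply: limr_le; first exact: psum_is_cvg.
apply: nearW => l; apply: le_trans (psum_prodL_le1 w k l).
by rewrite lerDl ltW// prodL_gt0.
Qed.

Lemma prodLD w k l m :
  prodL lam w k (l + m) = prodL lam w k l * prodL lam (shiftw l w) k m.
Proof.
by elim: m => [|m IH]; rewrite ?addn0 ?prodL0 ?mulr1// addnS !prodLS IH mulrA.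
Qed.

Lemma psumD w k l m :
  psum lam t w k (l + m) =
    psum lam t w k l + prodL lam w k l * psum lam t (shiftw l w) k m.
Proof.
elim: m => [|m IH]; first by rewrite addn0 {3}/psum big_ord0 mulr0 addr0.
rewrite addnS !psumS IH prodLD.
rewrite -[shiftw l w m]/(w (l + m)%N); ring.
Qed.

Lemma coding_shift w k l :
  coding lam t w k =
    psum lam t w k l + prodL lam w k l * coding lam t (shiftw l w) k.
Proof.
rewrite !codingE; apply/cvg_lim => //; rewrite -(cvg_shiftn l).
rewrite (_ : [sequence _]_n = fun m => psum lam t w k l +
    prodL lam w k l * psum lam t (shiftw l w) k m); last first.
  by apply/funext => m /=; rewrite addnC psumD.
apply: cvgD; first exact: cvg_cst.
by apply: cvgMr; exact: psum_is_cvg.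
Qed.

Lemma agree_prefix v w k l : (forall m, (m < l)%N -> agree lam t k (v m) (w m)) ->
  prodL lam v k l = prodL lam w k l /\ psum lam t v k l = psum lam t w k l.
Proof.
elim: l => [|l IH] h; first by rewrite !prodL0 /psum !big_ord0.
have [|h1 h2] := IH; first by move=> m ml; apply: h; rewrite ltnS ltnW.
have /andP[/eqP e1 /eqP e2] := h l (ltnSn l).
by rewrite !prodLS !psumS h1 h2 e1 e2.
Qed.

Lemma coding_diff v w k l : (forall m, (m < l)%N -> agree lam t k (v m) (w m)) ->
  coding lam t v k - coding lam t w k = prodL lam w k l *
    (coding lam t (shiftw l v) k - coding lam t (shiftw l w) k).
Proof.
move=> /agree_prefix[h1 h2]; rewrite (coding_shift v k l) (coding_shift w k l).
rewrite h1 h2; ring.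
Qed.

Lemma coding_near v w k l : (forall m, (m < l)%N -> agree lam t k (v m) (w m)) ->
  `|coding lam t v k - coding lam t w k| <= prodL lam w k l.
Proof.
move=> /coding_diff->; have p0 := ltW (prodL_gt0 lam01 w k l).
rewrite normrM (ger0_norm p0) ler_piMr// ler_norml.
have := coding_ge0 (shiftw l v) k; have := coding_le1 (shiftw l v) k.
have := coding_ge0 (shiftw l w) k; have := coding_le1 (shiftw l w) k.
lra.
Qed.

Lemma coding_head w k :
  coding lam t w k = lam (w 0%N) k * coding lam t (shiftw 1 w) k + t (w 0%N) k.
Proof.
rewrite (coding_shift w k 1) prodLS prodL0 psumS /psum big_ord0 prodL0; ring.
Qed.

(** Disjoint compact intervals have a positive gap, and there are only finitely many triples of two
    letters and a coordinate. *)
Lemma interval_gap : exists2 dl : R, 0 < dl <= 1 & forall i j k,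
  (forall x y, 0 <= x <= 1 -> 0 <= y <= 1 ->
     lam i k * x + t i k != lam j k * y + t j k) ->
  forall x y, 0 <= x <= 1 -> 0 <= y <= 1 ->
    dl <= `|lam i k * x + t i k - (lam j k * y + t j k)|.
Proof.
pose g (q : 'I_N.+1 * 'I_N.+1 * 'I_d) : R :=
  let: (i, j, k) := q in
  if t i k + lam i k < t j k then t j k - (t i k + lam i k) else
  if t j k + lam j k < t i k then t i k - (t j k + lam j k) else 1.
have [|m m0 hm] := @fin_family_lbound R _ g.
  by move=> [[i j] k]; rewrite /g; do 2?[case: ifPn => ?]; rewrite ?subr_gt0.
exists (Num.min m 1); first by rewrite lt_min m0 ltr01 ge_min lexx orbT.
move=> i j k dis x y x01 y01; rewrite ge_min; apply/orP; left.
apply: (le_trans (hm (i, j, k))); rewrite /g.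
have li := lam_gt0 lam01 i k; have lj := lam_gt0 lam01 j k.
have lx : 0 <= lam i k * x <= lam i k.
  by case/andP: x01 => ? ?; rewrite mulr_ge0 ?ler_piMr//= ltW.
have ly : 0 <= lam j k * y <= lam j k.
  by case/andP: y01 => ? ?; rewrite mulr_ge0 ?ler_piMr//= ltW.
case: ifPn => [h|]; first by rewrite ler_normr; apply/orP; right; lra.
rewrite -leNgt => h1.
case: ifPn => [h|]; first by rewrite ler_normr; apply/orP; left; lra.
rewrite -leNgt => h2; exfalso.
(* Two intervals that meet share the larger of their left endpoints; its preimages contradict
   disjointness, so the default value 1 of [g] is never reached. *)
pose c := Num.max (t i k) (t j k).
have [ci cj] : t i k <= c /\ t j k <= c by rewrite !le_max !lexx orbT.
have [ci' cj'] : c <= t i k + lam i k /\ c <= t j k + lam j k.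
  by rewrite !ge_max h1 h2 !lerDl !ltW.
have xr : 0 <= (c - t i k) / lam i k <= 1.
  by rewrite divr_ge0 ?subr_ge0 ?(ltW li)//= ler_pdivrMr// mul1r lerBlDl.
have yr : 0 <= (c - t j k) / lam j k <= 1.
  by rewrite divr_ge0 ?subr_ge0 ?(ltW lj)//= ler_pdivrMr// mul1r lerBlDl.
by have /negP := dis _ _ xr yr; apply; apply/eqP; field; rewrite !gt_eqF.
Qed.

(** The projected images are boxes: if they met in every coordinate below [n], the coordinatewise
    common points would combine into a common point of the boxes. *)
Lemma separated_coordinate (s : 'S_d) n i j :
  [set Defs.proj s n (ifs_map lam t i x) | x in @unit_cube R d] `&`
  [set Defs.proj s n (ifs_map lam t j x) | x in @unit_cube R d] = set0 ->
  exists2 k, ((s^-1)%g k < n)%N & forall x y, 0 <= x <= 1 -> 0 <= y <= 1 ->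
     lam i k * x + t i k != lam j k * y + t j k.
Proof.
move=> dis; apply: contrapT => H.
have H' : forall k, exists xy : R * R, ((s^-1)%g k < n)%N ->
    [/\ 0 <= xy.1 <= 1, 0 <= xy.2 <= 1 &
        lam i k * xy.1 + t i k = lam j k * xy.2 + t j k].
  move=> k; case: (boolP ((s^-1)%g k < n)%N) => kn; last by exists (0, 0).
  apply: contrapT => H2; apply: H; exists k => // x y x01 y01.
  by apply/eqP => e; apply: H2; exists (x, y).
have {H'}[f hf] := choice H'.
(* Outside the first [n] coordinates the choice is unconstrained, so it is replaced by 0 to stay in
   the cube. *)
pose sel (b : 'I_d -> R) k := if ((s^-1)%g k < n)%N then b k else 0.
suff : (set0 : set ('I_d -> R)) (Defs.proj s n (ifs_map lam t i (sel (fun k => (f k).1)))).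
  by [].
rewrite -dis; split.
  exists (sel (fun k => (f k).1)) => // k; rewrite /sel.
  by case: ifPn => [/hf[]//|_]; rewrite lexx ler01.
exists (sel (fun k => (f k).2)).
  move=> k; rewrite /sel; by case: ifPn => [/hf[]//|_]; rewrite lexx ler01.
apply/funext => k; rewrite /Defs.proj; case: ifPn => // kn.
by rewrite /ifs_map /sel kn; have [_ _ ->] := hf k kn.
Qed.

Hypothesis sppc : very_strong_SPPC lam t.

(** Let [l] be the first position where [v] violates some constraint. By [compat_segment] the maps
    of [v l] and [w l] do not overlap exactly on the corresponding $E_n^s$, so they have a gap [dl]
    in a coordinate [k] still prescribed at [l]. Up to [l] the two words agree in [k], hence the gap
    is scaled by [prodL w k l], which exceeds [r] because [k] has not stopped. *)
Lemma acube_separation : exists2 dl : R, 0 < dl <= 1 &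
  forall (s : 'S_d) v w (r : R), inA lam s -> 0 < r ->
    compat s (stopL lam w r) -> ~ acube lam t w (stopL lam w r) v ->
    exists k, dl * r < `|coding lam t v k - coding lam t w k|.
Proof.
have [dl dl01 gap] := interval_gap; exists dl => // s v w r sA r0 cs nv.
set L := stopL lam w r in cs nv.
have ex : exists l, [exists k, (l < L k)%N && ~~ agree lam t k (v l) (w l)].
  apply: contrapT => H; apply: nv => l k lk; apply: contrapT => /negP na.
  by apply: H; exists l; apply/existsP; exists k; rewrite lk.
case: (ex_minnP ex) => l /existsP[k0 /andP[lk0 nak0]] lmin.
have [n nd hn] := compat_segment l cs.
have hn' k : ((s^-1)%g k < n)%N = (l < L k)%N by rewrite hn permKV.
have n0 : (0 < n)%N by move: lk0; rewrite -hn'; case: (n).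
case: (sppc sA (n := n) _ (v l) (w l)); rewrite ?n0 ?nd//.
  by move/overlapP/(_ k0); rewrite hn' lk0 (negbTE nak0) => /(_ isT).
move=> /separated_coordinate[k kn /gap g]; exists k.
rewrite hn' in kn.
rewrite (@coding_diff v w k l); last first.
  move=> m ml; apply: contrapT => /negP na.
  have : (l <= m)%N.
    apply: lmin; apply/existsP; exists k; rewrite na andbT; exact: ltn_trans kn.
  by rewrite leqNgt ml.
rewrite normrM (ger0_norm (ltW (prodL_gt0 lam01 w k l))).
have rp : r < prodL lam w k l by rewrite -lt_stopL.
rewrite (coding_head (shiftw l v)) (coding_head (shiftw l w)).
have vl : shiftw l v 0%N = v l by rewrite /shiftw addn0.
have wl : shiftw l w 0%N = w l by rewrite /shiftw addn0.
rewrite vl wl.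
case/andP: dl01 => dl0 _.
rewrite mulrC; apply: (@lt_le_trans _ _ (prodL lam w k l * dl)).
  by rewrite ltr_pM2r.
apply: ler_wpM2l; first exact: ltW (prodL_gt0 lam01 w k l).
by apply: g; rewrite coding_ge0 coding_le1.
Qed.

Lemma acube_coding v w (r : R) : 0 < r ->
  acube lam t w (stopL lam w r) v ->
  forall k, `|coding lam t v k - coding lam t w k| <= r.
Proof.
move=> r0 hv k; apply: (@le_trans _ _ (prodL lam w k (stopL lam w r k))).
  by apply: coding_near => m mk; exact: hv.
exact: prodL_stopL.
Qed.

End Coding.

(** * Bernoulli mass and measurability *)

Definition amass (R : realType) (d N : nat) (lam t : 'I_N.+1 -> 'I_d -> R)
    (p : 'I_N.+1 -> R) (Ls : 'I_d -> nat) (l : nat) (i : 'I_N.+1) : R :=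
  \sum_(j | [forall k, (l < Ls k)%N ==> agree lam t k j i]) p j.

Section CylinderSets.
Variable N : nat.
Implicit Types (A : set (Sigma N)) (v w : Sigma N).

Lemma cyl_measurable w n : measurable (cyl w n : set (SigmaM N)).
Proof. by apply: sub_sigma_algebra; exists w, n. Qed.

Definition extw n (u : {ffun 'I_n -> 'I_N.+1}) : Sigma N :=
  fun m => if insub m is Some m' then u m' else ord0.

Lemma extwE n (u : {ffun 'I_n -> 'I_N.+1}) (m : 'I_n) : extw u m = u m.
Proof. by rewrite /extw valK. Qed.

Lemma prefix_set_bigcup A n : (forall v, A v -> cyl v n `<=` A) ->
  A = \bigcup_(u in [set` enum [pred u : {ffun 'I_n -> 'I_N.+1} | `[< A (extw u) >]]])
        cyl (extw u) n.
Proof.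
move=> hA; apply/seteqP; split=> [v Av|v [u]]; last first.
  by rewrite /= mem_enum => /asboolP Au; exact: (hA _ Au).
exists [ffun m : 'I_n => v m].
  rewrite /= mem_enum; apply/asboolP; apply: (hA v Av) => k kn.
  by rewrite -[k]/(nat_of_ord (Ordinal kn)) extwE ffunE.
by move=> k kn; rewrite -[k]/(nat_of_ord (Ordinal kn)) extwE ffunE.
Qed.

Lemma prefix_set_measurable A n : (forall v, A v -> cyl v n `<=` A) ->
  measurable (A : set (SigmaM N)).
Proof.
move=> /prefix_set_bigcup ->; apply: fin_bigcup_measurable.
  exact: finite_finpred.
by move=> u _; exact: cyl_measurable.
Qed.

(** The words whose [n]-th cylinder lies in [A] form a set depending on [n] letters only, and these
    sets exhaust [A]. *)
Lemma open_set_measurable A : (forall v, A v -> exists n, cyl v n `<=` A) ->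
  measurable (A : set (SigmaM N)).
Proof.
move=> hA; have -> : A = \bigcup_n [set v | cyl v n `<=` A].
  apply/seteqP; split=> [v /hA[n hn]|v [n _]]; first by exists n.
  by apply; move=> k.
apply: bigcup_measurable => n _; apply: (@prefix_set_measurable _ n).
move=> v hv u uv u' u'u; apply: hv => k kn; rewrite u'u// uv//.
Qed.

Lemma cylinder_continuous_measurable (R : realType) (f : Sigma N -> R) :
  (forall v (e : R), 0 < e -> exists n, forall u, cyl v n u -> `|f u - f v| < e) ->
  measurable_fun [set: SigmaM N] (f : SigmaM N -> R).
Proof.
move=> hf; apply: (measurability (measurable_realfun.RGenOInfty.G (R := R))).
  exact: measurable_realfun.RGenOInfty.measurableE.
move=> _ [_ [x ->] <-]; rewrite setTI.
apply: open_set_measurable => v /=; rewrite in_itv/= andbT => xv.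
have [|n hn] := hf v (f v - x); first by rewrite subr_gt0.
exists n => u /hn; rewrite /= in_itv/= andbT ltr_norml; lra.
Qed.

End CylinderSets.

Section BernoulliMass.
Variables (R : realType) (N : nat) (p : 'I_N.+1 -> R).
Variable mu : probability (SigmaM N) R.
Hypothesis bern : is_bernoulli p mu.

Lemma bernoulli_product n (Q : nat -> pred 'I_N.+1) :
  mu [set v : SigmaM N | forall l, (l < n)%N -> Q l (v l)] =
  (\prod_(l < n) \sum_(j | Q l j) p j)%:E.
Proof.
set A := (X in mu X).
have hA v : A v -> cyl v n `<=` A.
  by move=> Av u uv l ln; rewrite uv//; exact: Av.
rewrite (prefix_set_bigcup hA); set r := enum _.
have hD u : (u \in r) = (u \in family (fun l : 'I_n => Q l)).
  rewrite /r mem_enum; apply/asboolP/familyP => [h l|h l ln].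
    by have := h l (ltn_ord l); rewrite extwE.
  by have := h (Ordinal ln); rewrite -[l]/(nat_of_ord (Ordinal ln)) extwE.
rewrite measure_fin_bigcup; last first.
- by move=> u _; exact: cyl_measurable.
- move=> u u' _ _ [v [h1 h2]]; apply/ffunP => m.
  by rewrite -(extwE u) -(extwE u') -h1// -h2.
- exact: finite_finpred.
rewrite -fsbig_seq ?enum_uniq//.
rewrite (bigA_distr_big_dep (fun l : 'I_n => Q l)) -sumEFin.
rewrite -[RHS]big_enum /=.
under eq_bigr => u _.
  rewrite bern (eq_bigr (fun l => p (u l))); last by move=> l _; rewrite extwE.
  over.
apply: perm_big; apply: uniq_perm; rewrite ?enum_uniq// => u.
by rewrite hD mem_enum.
Qed.

Hypothesis p0 : forall i, 0 < p i.

Lemma cyl_mass_gt0 w n : (0 < mu (cyl w n))%E.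
Proof. by rewrite bern lte_fin prodr_gt0. Qed.

End BernoulliMass.

Section ApproximateCubes.
Variables (R : realType) (d N : nat) (lam t : 'I_N.+1 -> 'I_d -> R).
Variables (p : 'I_N.+1 -> R) (mu : probability (SigmaM N) R).
Hypothesis lam01 : forall i n, 0 < lam i n < 1.
Hypothesis fcube : forall i x, unit_cube x -> unit_cube (ifs_map lam t i x).
Hypothesis p0 : forall i, 0 < p i.
Hypothesis bern : is_bernoulli p mu.
Implicit Types (v w : Sigma N) (Ls : 'I_d -> nat).

Lemma acubeE w Ls n : (forall k, Ls k <= n)%N ->
  acube lam t w Ls = [set v | forall l, (l < n)%N ->
     [pred j | [forall k, (l < Ls k)%N ==> agree lam t k j (w l)]] (v l)].
Proof.
move=> hn; apply/seteqP; split=> v hv l.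
  by move=> _; apply/forallP => k; apply/implyP => /hv.
move=> k lk; have /forallP/(_ k)/implyP := hv l (leq_trans lk (hn k)).
exact.
Qed.

(** Any common bound [n] will do, since positions beyond all stopping times are unconstrained. Two
    scales can thus be compared factor by factor over the same range. *)
Lemma mu_acube w Ls n : (forall k, Ls k <= n)%N ->
  mu (acube lam t w Ls) = (\prod_(l < n) amass lam t p Ls l (w l))%:E.
Proof.
move=> hn; rewrite (acubeE w hn).
by rewrite (bernoulli_product bern n (fun l =>
  [pred j | [forall k, (l < Ls k)%N ==> agree lam t k j (w l)]])).
Qed.

Lemma acube_measurable w Ls : measurable (acube lam t w Ls : set (SigmaM N)).
Proof.
rewrite (@acubeE _ _ (\max_k Ls k)); last by move=> k; exact: leq_bigmax.
apply: (@prefix_set_measurable _ _ (\max_k Ls k)) => v hv u uv l ln.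
by rewrite uv//; exact: hv.
Qed.

Lemma coding_measurable k :
  measurable_fun [set: SigmaM N] (fun v : SigmaM N => coding lam t v k).
Proof.
apply: (@cylinder_continuous_measurable N R (fun v => coding lam t v k)) => v e e0.
have e20 : 0 < e / 2 by rewrite divr_gt0.
exists (stopL lam v (e / 2) k) => u uv.
apply: (@le_lt_trans _ _ (e / 2)); last by rewrite ltr_pdivrMr// ltr_pMr// ltr1n.
apply: (le_trans (coding_near lam01 fcube _)) (prodL_stopL lam01 v k e20).
by move=> m mk; rewrite uv// agree_refl.
Qed.

Lemma edist_coding_measurable x :
  measurable_fun [set: SigmaM N] (fun v : SigmaM N => Defs.edist x (coding lam t v)).
Proof.
apply: (measurableT_comp (f := @Num.sqrt R)).
  by apply: measurable_realfun.continuous_measurable_fun; exact: sqrt_continuous.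
apply: measurable_sum => k; apply: measurable_realfun.measurable_funX.
apply: measurable_realfun.measurable_funB; first exact: measurable_cst.
exact: coding_measurable.
Qed.

Lemma cball_measurable x r :
  measurable (coding lam t @^-1` cball x r : set (SigmaM N)).
Proof.
have := @edist_coding_measurable x measurableT `]-oo, r]%classic (measurable_itv _).
rewrite setTI; congr (measurable _); apply/seteqP; split=> v /=;
  by rewrite in_itv.
Qed.

Lemma oball_measurable x r :
  measurable (coding lam t @^-1` oball x r : set (SigmaM N)).
Proof.
have := @edist_coding_measurable x measurableT `]-oo, r[%classic (measurable_itv _).
rewrite setTI; congr (measurable _); apply/seteqP; split=> v /=;
  by rewrite in_itv.
Qed.

Lemma fine_mu_le (A B : set (SigmaM N)) : measurable A -> measurable B ->
  A `<=` B -> fine (mu A) <= fine (mu B).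
Proof.
move=> mA mB AB; apply: fine_le; rewrite ?fin_num_measure//.
by apply: le_measure; rewrite ?inE.
Qed.

Lemma coding_supp w : supp lam t mu (coding lam t w).
Proof.
move=> r r0; rewrite /Defs.nu.
(* Dividing by [d.+1] instead of [d] makes the final inequality strict, as the open ball
   requires. *)
have e0 : 0 < r / (d.+1%:R) by rewrite divr_gt0.
pose n := \max_k stopL lam w (r / d.+1%:R) k.
apply: (@lt_le_trans _ _ (fine (mu (cyl w n)))).
  rewrite fine_gt0// (cyl_mass_gt0 bern p0)/=.
  by rewrite ltey_eq fin_num_measure//; exact: cyl_measurable.
apply: fine_mu_le; [exact: cyl_measurable|exact: oball_measurable|].
move=> v vw; rewrite /= /oball/=.
apply: (@le_lt_trans _ _ (d%:R * (r / d.+1%:R))).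
  apply: edist_le_coord => k; rewrite distrC.
  apply: (le_trans (coding_near lam01 fcube _)) (prodL_stopL lam01 w k e0).
  move=> m mk; rewrite vw ?agree_refl//; apply: (leq_trans mk).
  exact: (leq_bigmax k).
by rewrite mulrA ltr_pdivrMr// mulrC ltr_pM2l// ltr_nat.
Qed.

(** Takes the place of identifying the support with the attractor: the distance to a coded point is
    absorbed into the radii. *)
Lemma supp_approx x e : supp lam t mu x -> 0 < e ->
  exists w, Defs.edist x (coding lam t w) < e.
Proof.
move=> sx e0; have := sx e e0; rewrite /Defs.nu => h.
apply: contrapT => H; move: h; rewrite (_ : _ @^-1` _ = set0) ?measure0 ?ltxx//.
by apply/seteqP; split=> // v hv; apply: H; exists v.
Qed.

End ApproximateCubes.

(** * Overlap classes and conditional masses *)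

Definition ovb (R : realType) (d N : nat) (lam t : 'I_N.+1 -> 'I_d -> R)
    (s : 'S_d) (n : nat) (i j : 'I_N.+1) : bool :=
  [forall k, ((s^-1)%g k < n)%N ==> agree lam t k i j].

(** This is $p_n^s(\Pi_n^s i)$, taken as a function of every letter [i] and not only of the
    representatives. *)
Definition class_mass (R : realType) (d N : nat) (lam t : 'I_N.+1 -> 'I_d -> R)
    (p : 'I_N.+1 -> R) (s : 'S_d) (n : nat) (i : 'I_N.+1) : R :=
  \sum_(j | ovb lam t s n j i) p j.

(** This is $-\log P_n^s(\Pi_{n+1}^s i)$, with [n] counted from 0. *)
Definition cond_cost (R : realType) (d N : nat) (lam t : 'I_N.+1 -> 'I_d -> R)
    (p : 'I_N.+1 -> R) (s : 'S_d) (n : nat) (i : 'I_N.+1) : R :=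
  - ln (class_mass lam t p s n.+1 i / class_mass lam t p s n i).

Section IndexSets.
Variables (R : realType) (d N : nat) (lam t : 'I_N.+1 -> 'I_d -> R).
Hypothesis finj : forall i j, i != j ->
     ~ (forall x, unit_cube x -> ifs_map lam t i x = ifs_map lam t j x).
Variable s : 'S_d.
Implicit Types (i j : 'I_N.+1) (n m : nat).
Local Notation ov := (ovb lam t s).
Local Notation Iset := (Iset lam t s).
Local Notation projidx := (projidx lam t s).

Lemma ovP n i j : reflect (overlap lam t s n i j) (ov n i j).
Proof.
apply: (iffP forallP) => [h|/overlapP h k].
  by apply/overlapP => k kn; have /implyP := h k; apply.
by apply/implyP; exact: h.
Qed.

Lemma ov_refl n i : ov n i i.
Proof. by apply/forallP => k; rewrite agree_refl implybT. Qed.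

Lemma ov_sym n i j : ov n i j = ov n j i.
Proof. by apply: eq_forallb => k; rewrite agree_sym. Qed.

Lemma ov_trans n i j i' : ov n i j -> ov n j i' -> ov n i i'.
Proof.
move=> /forallP h1 /forallP h2; apply/forallP => k; apply/implyP => kn.
have /implyP/(_ kn) a1 := h1 k; have /implyP/(_ kn) a2 := h2 k.
exact: agree_trans a1 a2.
Qed.

Lemma ov_le m n i j : (m <= n)%N -> ov n i j -> ov m i j.
Proof.
move=> mn /forallP h; apply/forallP => k; apply/implyP => km.
by have /implyP := h k; apply; exact: leq_trans km mn.
Qed.

(** Level 0 thus has a single overlap class, which stands for the empty index. *)
Lemma ov0 i j : ov 0 i j.
Proof. by apply/forallP => k. Qed.

Lemma ov_full i j : ov d i j -> i = j.
Proof.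
move=> h; apply/eqP; apply: contrapT => /negP ne; apply: (finj ne) => x ux.
apply/funext => k; have /implyP := (forallP h) k; rewrite ltn_ord => /(_ isT).
by move=> /andP[/eqP h1 /eqP h2]; rewrite /ifs_map h1 h2.
Qed.

Lemma ov_lam (n : 'I_d) i j : ov n.+1 i j -> lam i (s n) = lam j (s n).
Proof.
move=> /forallP/(_ (s n)); rewrite permK ltnS leqnn.
by move=> /andP[/eqP].
Qed.

Lemma Iset_inj n i j : Iset n i -> Iset n j -> ov n i j -> i = j.
Proof.
have [->|nd] := eqVneq n d; first by move=> _ _; exact: ov_full.
move=> [/eqP|hi]; first by rewrite (negbTE nd).
move=> [/eqP|hj]; first by rewrite (negbTE nd).
move=> o; case: (ltngtP i j) => [ij|ji|/val_inj//].
  by case: hj; exists i; split=> //; apply/ovP.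
by case: hi; exists j; split=> //; apply/ovP; rewrite ov_sym.
Qed.

Lemma projidxP n j : Iset n (projidx n j) /\ ov n (projidx n j) j.
Proof.
rewrite /Defs.projidx; case: ifPn => [/eqP->|nd]; first by split; [left|exact: ov_refl].
set P := (X in xget j X); suff [h1 /ovP h2] : P (xget j P) by split.
apply: xgetPex.
have ex : exists m, [exists i : 'I_N.+1, (nat_of_ord i == m) && ov n i j].
  by exists j; apply/existsP; exists j; rewrite eqxx ov_refl.
case: (ex_minnP ex) => m /existsP[i /andP[/eqP im oij]] mmin.
exists i; split; last exact/ovP.
right=> -[i' [i'i /ovP oi']].
have : (m <= i')%N.
  apply: mmin; apply/existsP; exists i'; rewrite eqxx/=; exact: ov_trans oij.
by rewrite -im leqNgt i'i.
Qed.

Lemma Iset_projidx n j : Iset n (projidx n j).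
Proof. by case: (projidxP n j). Qed.

Lemma ov_projidx n j : ov n (projidx n j) j.
Proof. by case: (projidxP n j). Qed.

Lemma projidx_id n i : Iset n i -> projidx n i = i.
Proof.
by move=> h; apply: (@Iset_inj n) => //; [exact: Iset_projidx|exact: ov_projidx].
Qed.

Lemma projidx_eq n i j : (projidx n i == projidx n j) = ov n i j.
Proof.
apply/eqP/idP => [e|o].
  rewrite (@ov_trans n _ (projidx n i))// 1?ov_sym ?ov_projidx//.
  by rewrite e ov_sym ov_projidx.
apply: (@Iset_inj n); try exact: Iset_projidx.
apply: (ov_trans (ov_projidx n i)); apply: (ov_trans o).
by rewrite ov_sym ov_projidx.
Qed.

Lemma projidx_comp m n i : (m <= n)%N -> projidx m (projidx n i) = projidx m i.
Proof.
by move=> mn; apply/eqP; rewrite projidx_eq; apply: (ov_le mn); exact: ov_projidx.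
Qed.

Lemma Iset_exists n : exists i, Iset n i.
Proof. by exists (projidx n ord0); exact: Iset_projidx. Qed.

Lemma Iset_le m n i : (m < n)%N -> (n <= d)%N -> Iset m i -> Iset n i.
Proof.
move=> mn nd [md|h]; first by lia.
right=> -[j [ji o]]; apply: h; exists j; split=> //.
by apply/ovP; apply: (ov_le (ltnW mn)); apply/ovP.
Qed.

Section Masses.
Variable p : 'I_N.+1 -> R.
Local Notation cmass := (class_mass lam t p s).
Local Notation cost := (cond_cost lam t p s).
Local Notation ratio := (Defs.ratio lam t p s).

Lemma pmass_cmass n i : (0 < n)%N -> pmass lam t p s n (projidx n i) = cmass n i.
Proof.
move=> n0; rewrite /pmass gtn_eqF//; apply: eq_bigl => j.
by rewrite projidx_eq.
Qed.

(** The maxima run over nonempty finite sets, so the extended-real sum is real and attained. The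
    maximising letters [f n] are the ones later inserted into the windows. *)
Lemma SbarP : exists f : 'I_d -> 'I_N.+1,
  [/\ forall n : 'I_d, Iset n.+1 (f n),
      Sbar lam t p s = (\sum_n ratio n (f n))%:E &
      forall (n : 'I_d) i, Iset n.+1 i -> ratio n i <= ratio n (f n)].
Proof.
have H (n : 'I_d) : exists i0, Iset n.+1 i0 /\
    \big[maxe/-oo%E]_(i : 'I_N.+1 | `[< Iset n.+1 i >]) (ratio n i)%:E
      = (ratio n i0)%:E.
  have [j hj] := Iset_exists n.+1.
  have [||i0 h1 h2] := @eq_bigmax _ _ _ -oo%E j (fun i => `[< Iset n.+1 i >])
    (fun i => (ratio n i)%:E).
  - exact/asboolP.
  - by move=> i _; rewrite leNye.
  - by exists i0; split=> //; apply/asboolP.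
have [f hf] := choice H; exists f; split; first by move=> n; case: (hf n).
  rewrite /Sbar -sumEFin; apply: eq_bigr => n _; by case: (hf n).
move=> n i hi; rewrite -lee_fin; case: (hf n) => _ <-.
by apply: (le_bigmax_cond _ (fun i => (ratio n i)%:E)); exact/asboolP.
Qed.

Lemma SunderP : exists f : 'I_d -> 'I_N.+1,
  [/\ forall n : 'I_d, Iset n.+1 (f n),
      Sunder lam t p s = (\sum_n ratio n (f n))%:E &
      forall (n : 'I_d) i, Iset n.+1 i -> ratio n (f n) <= ratio n i].
Proof.
have H (n : 'I_d) : exists i0, Iset n.+1 i0 /\
    \big[mine/+oo%E]_(i : 'I_N.+1 | `[< Iset n.+1 i >]) (ratio n i)%:E
      = (ratio n i0)%:E.
  have [j hj] := Iset_exists n.+1.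
  have [||i0 h1 h2] := @eq_bigmin _ _ _ +oo%E j (fun i => `[< Iset n.+1 i >])
    (fun i => (ratio n i)%:E).
  - exact/asboolP.
  - by move=> i _; rewrite leey.
  - by exists i0; split=> //; apply/asboolP.
have [f hf] := choice H; exists f; split; first by move=> n; case: (hf n).
  rewrite /Sunder -sumEFin; apply: eq_bigr => n _; by case: (hf n).
move=> n i hi; rewrite -lee_fin; case: (hf n) => _ <-.
by apply: (bigmin_le_cond _ (fun i => (ratio n i)%:E)); exact/asboolP.
Qed.

Hypothesis p0 : forall i, 0 < p i.
Hypothesis p1 : \sum_i p i = 1.

Lemma cmass0 i : cmass 0 i = 1.
Proof. by rewrite -p1; apply: eq_bigl => j; rewrite ov0. Qed.

Lemma pmassE n i : pmass lam t p s n (projidx n i) = cmass n i.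
Proof.
by case: n => [|n]; [rewrite cmass0 | rewrite pmass_cmass].
Qed.

Lemma cmass_ge n i : p i <= cmass n i.
Proof.
rewrite /class_mass (bigD1 i) ?ov_refl//= lerDl sumr_ge0// => j _; exact: ltW.
Qed.

Lemma cmass_gt0 n i : 0 < cmass n i.
Proof. exact: lt_le_trans (cmass_ge n i). Qed.

Lemma le_cmass m n i : (m <= n)%N -> cmass n i <= cmass m i.
Proof.
move=> mn; rewrite /class_mass big_mkcond [leRHS]big_mkcond/=.
apply: ler_sum => j _; case: ifPn => [/(ov_le mn)->//|_].
by case: ifP => // _; exact: ltW.
Qed.

Lemma cmass_le1 n i : cmass n i <= 1.
Proof. by rewrite -(cmass0 i); exact: le_cmass. Qed.

Lemma cost_ge0 n i : 0 <= cost n i.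
Proof.
by rewrite oppr_ge0 ln_le0// ler_pdivrMr ?cmass_gt0// mul1r le_cmass.
Qed.

Lemma cost_le (pm : R) n i : 0 < pm -> (forall i, pm <= p i) -> cost n i <= - ln pm.
Proof.
move=> pm0 hp; rewrite lerN2 ler_ln ?posrE ?divr_gt0 ?cmass_gt0//.
rewrite ler_pdivlMr ?cmass_gt0// (le_trans _ (cmass_ge n.+1 i))//.
by rewrite (le_trans _ (hp i))// ler_piMr ?cmass_le1// ltW.
Qed.

(** No bound on the contraction ratios is assumed yet: when the logarithm vanishes, division by zero
    makes the ratio 0. *)
Lemma ratio_projidx (n : 'I_d) i :
  ratio n (projidx n.+1 i) * - ln (lam i (s n)) =
  if ln (lam i (s n)) == 0 then 0 else cost n i.
Proof.
rewrite /Defs.ratio /Pcond /= projidx_comp// !pmassE.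
rewrite (ov_lam (ov_projidx n.+1 i)).
by case: ifPn => [/eqP->|h]; rewrite ?oppr0 ?mulr0// mulrN divfK.
Qed.

Lemma ratio_ge0 (n : 'I_d) i : (forall i (k : 'I_d), 0 < lam i k < 1) ->
  Iset n.+1 i -> 0 <= ratio n i.
Proof.
move=> lam01 hi; have := ratio_projidx n i; rewrite projidx_id//.
have h := nln_lam_gt0 lam01 i (s n).
rewrite lt_eqF -?oppr_gt0// => e.
by rewrite -(pmulr_lge0 _ h) e cost_ge0.
Qed.

Hypothesis lam01 : forall i (k : 'I_d), 0 < lam i k < 1.

Lemma cost_le_ratio (f : 'I_d -> 'I_N.+1) :
  (forall (n : 'I_d) i, Iset n.+1 i -> ratio n i <= ratio n (f n)) ->
  forall (n : 'I_d) i, cost n i <= ratio n (f n) * - ln (lam i (s n)).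
Proof.
move=> hf n i; have h := nln_lam_gt0 lam01 i (s n).
have := ratio_projidx n i; rewrite lt_eqF -?oppr_gt0// => <-.
by rewrite ler_pM2r// hf//; exact: Iset_projidx.
Qed.

Lemma cost_ge_ratio (f : 'I_d -> 'I_N.+1) :
  (forall (n : 'I_d) i, Iset n.+1 i -> ratio n (f n) <= ratio n i) ->
  forall (n : 'I_d) i, ratio n (f n) * - ln (lam i (s n)) <= cost n i.
Proof.
move=> hf n i; have h := nln_lam_gt0 lam01 i (s n).
have := ratio_projidx n i; rewrite lt_eqF -?oppr_gt0// => <-.
by rewrite ler_pM2r// hf//; exact: Iset_projidx.
Qed.

Lemma cost_ratio (n : 'I_d) i : Iset n.+1 i ->
  cost n i = ratio n i * - ln (lam i (s n)).
Proof.
move=> hi; have := ratio_projidx n i; rewrite projidx_id// => ->.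
by rewrite lt_eqF// -oppr_gt0 nln_lam_gt0.
Qed.

(** If the first [m] coordinates of [s] are prescribed at [l], the admissible letters are one
    overlap class of level [m]; its mass telescopes down to level 0, where it is 1. *)
Lemma amass_compat (Ls : 'I_d -> nat) l i : compat s Ls ->
  amass lam t p Ls l i =
  \prod_(n < d | (l < Ls (s n))%N) (cmass n.+1 i / cmass n i).
Proof.
move=> cs; have [m md hm] := compat_segment l cs.
under eq_bigl => n do rewrite -hm.
rewrite -(big_ord_widen d (fun n => cmass n.+1 i / cmass n i) md).
have -> : amass lam t p Ls l i = cmass m i.
  apply: eq_bigl => j; apply: eq_forallb => k.
  by rewrite -[k in (l < Ls k)%N](permKV s) -hm.
elim: {md hm} m => [|m IH]; first by rewrite big_ord0 cmass0.
by rewrite big_ord_recr/= -IH mulrC divfK ?gt_eqF ?cmass_gt0.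
Qed.

Lemma nln_mu_acube (mu : probability (SigmaM N) R) w (Ls : 'I_d -> nat) :
  is_bernoulli p mu -> compat s Ls ->
  - ln (fine (mu (acube lam t w Ls))) =
  \sum_(n < d) \sum_(l < Ls (s n)) cost n (w l).
Proof.
move=> bern cs; pose M := (\max_k Ls k)%N.
have LM k : (Ls k <= M)%N by exact: leq_bigmax.
rewrite (mu_acube lam t bern w LM) /= ln_prod; last first.
  move=> l; rewrite amass_compat//; apply: prodr_gt0 => n _.
  by rewrite divr_gt0 ?cmass_gt0.
under [X in - X = _]eq_bigr => l _.
  rewrite amass_compat// ln_prod; last by move=> n; rewrite divr_gt0 ?cmass_gt0.
  over.
rewrite /= (exchange_big_dep xpredT)//= -sumrN; apply: eq_bigr => n _.
rewrite -sumrN (big_ord_widen _ (fun l => cost n (w l)) (LM (s n))).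
by [].
Qed.

End Masses.
End IndexSets.

(** * Growth of the mass along the scales *)

Section Growth.
Variables (R : realType) (d N : nat) (lam t : 'I_N.+1 -> 'I_d -> R).
Variables (p : 'I_N.+1 -> R) (mu : probability (SigmaM N) R).
Hypothesis lam01 : forall i n, 0 < lam i n < 1.
Hypothesis finj : forall i j, i != j ->
     ~ (forall x, unit_cube x -> ifs_map lam t i x = ifs_map lam t j x).
Hypothesis p0 : forall i, 0 < p i.
Hypothesis p1 : \sum_i p i = 1.
Hypothesis bern : is_bernoulli p mu.
Implicit Types (v w : Sigma N) (r : R).

Local Notation mass w r := (fine (mu (acube lam t w (stopL lam w r)))).

Lemma is_stop_stopL w r k L : 0 < r -> is_stop lam w r k L -> stopL lam w r k = L.
Proof.
move=> r0 /andP[h1 h2]; have : (stopL lam w r k <= L)%N.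
  by rewrite leqNgt lt_stopL// -leNgt.
by move: h2; rewrite -lt_stopL//; lia.
Qed.

Lemma ordered_cube_compat w r s : 0 < r -> ordered_cube lam w r s ->
  compat s (stopL lam w r).
Proof.
move=> r0 [Ls [h1 [h2 _]]] a b ab.
by rewrite !(is_stop_stopL r0 (h1 _)); exact: h2.
Qed.

Lemma compat_exists w r : 0 < r ->
  exists s, inA lam s /\ compat s (stopL lam w r).
Proof.
move=> r0; have [r1|r1] := ltP r 1.
  have [|s hs] := @ordered_cube_exists _ _ _ _ lam01 w r; first by rewrite r0.
  by exists s; split; [exists w, r|exact: ordered_cube_compat hs].
(* At scales [r >= 1] all stopping times vanish and every permutation is compatible; one in class A
   is borrowed from the scale 1/2. *)
have h01 : 0 < (2^-1 : R) < 1 by rewrite invr_gt0 ltr0n/= invf_lt1// ltr1n.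
have [s hs] := ordered_cube_exists lam01 w h01.
exists s; split; first by exists w, 2^-1; case/andP: h01.
by move=> a b _; rewrite !stopL_ge1.
Qed.

Lemma amass_gt0 Ls l i : 0 < amass lam t p Ls l i.
Proof.
rewrite /amass (bigD1 i)/=; last by apply/forallP => k; rewrite agree_refl implybT.
by rewrite ltr_pwDl// sumr_ge0// => j _; exact: ltW.
Qed.

Lemma amass_le1 Ls l i : amass lam t p Ls l i <= 1.
Proof.
rewrite -p1 /amass big_mkcond/=; apply: ler_sum => j _.
by case: ifP => // _; exact: ltW.
Qed.

Lemma amass_ge Ls l i : p i <= amass lam t p Ls l i.
Proof.
rewrite /amass (bigD1 i)/=; last by apply/forallP => k; rewrite agree_refl implybT.
by rewrite lerDl sumr_ge0// => j _; exact: ltW.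
Qed.

Lemma mass_gt0 w r : 0 < mass w r.
Proof.
rewrite (mu_acube lam t bern w (n := \max_k stopL lam w r k)); last first.
  by move=> k; exact: leq_bigmax.
by apply: prodr_gt0 => l _; exact: amass_gt0.
Qed.

Lemma mass_ge1 w r : 1 <= r -> mass w r = 1.
Proof.
move=> r1; rewrite (mu_acube lam t bern w (n := 0)) ?big_ord0//.
by move=> k; rewrite stopL_ge1.
Qed.

Lemma nln_mass_diff (s : 'S_d) w r r' : 0 < r -> r <= r' ->
  compat s (stopL lam w r) -> compat s (stopL lam w r') ->
  - ln (mass w r) - - ln (mass w r') =
  \sum_(n < d) \sum_(stopL lam w r' (s n) <= l < stopL lam w r (s n))
     cond_cost lam t p s n (w l).
Proof.
move=> r0 rr' c c'; rewrite (nln_mu_acube lam t p0 p1 w bern c) (nln_mu_acube lam t p0 p1 w bern c').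
rewrite -sumrB; apply: eq_bigr => n _.
rewrite -!(big_mkord xpredT (fun l => cond_cost lam t p s n (w l))).
by rewrite (big_cat_nat (leq0n _) (le_stopL lam01 w (s n) r0 rr'))/= addrAC subrr add0r.
Qed.

(** No common ordering is assumed. Factors differ only at positions lying between the two stopping
    times of some coordinate, each such factor costs at most [- ln pm], and heights bound the number
    of positions. *)
Lemma nln_mass_adj hmin hmax pm : 0 < hmin ->
  (forall i k, hmin <= - ln (lam i k) <= hmax) -> 0 < pm ->
  (forall i, pm <= p i) -> forall w r r', 0 < r -> r <= r' -> r' <= 1 ->
  - ln (mass w r) - - ln (mass w r') <=
    d%:R * ((ln (r' / r) + hmax) / hmin * - ln pm).
Proof.
move=> hm0 hh pm0 hp w r r' r0 rr' r1; have r'0 := lt_le_trans r0 rr'.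
have lpm : 0 <= - ln pm.
  rewrite oppr_ge0 ln_le0// (le_trans (hp ord0))// -p1 (bigD1 ord0)//= lerDl.
  by rewrite sumr_ge0// => i _; exact: ltW.
pose L := stopL lam w r; pose L' := stopL lam w r'.
have LL k : (L' k <= L k)%N by exact: le_stopL.
pose M := (\max_k L k)%N.
have LM k : (L k <= M)%N by exact: leq_bigmax.
have LM' k : (L' k <= M)%N by exact: leq_trans (LL k) (LM k).
rewrite (mu_acube lam t bern w LM) (mu_acube lam t bern w LM') /=.
rewrite !ln_prod; try by move=> l; exact: amass_gt0.
rewrite -!sumrN -big_split/=.
have step (l : 'I_M) : - ln (amass lam t p L l (w l)) -
    - ln (amass lam t p L' l (w l)) <=
    \sum_(k < d) if (L' k <= l < L k)%N then - ln pm else 0.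
  case: (boolP [exists k, (L' k <= l < L k)%N]) => [/existsP[k hk]|].
    rewrite (bigD1 k)//= hk; apply: (@le_trans _ _ (- ln pm)); last first.
      by rewrite lerDl sumr_ge0// => j _; case: ifP.
    rewrite opprK ler_wnDr ?ln_le0 ?amass_le1// lerN2 ler_ln ?posrE ?amass_gt0//.
    exact: le_trans (hp _) (amass_ge _ _ _).
  rewrite negb_exists => /forallP h.
  have -> : amass lam t p L l (w l) = amass lam t p L' l (w l).
    apply: eq_bigl => j; apply: eq_forallb => k; suff -> : (l < L k)%N = (l < L' k)%N by [].
    have := h k; have := LL k; move: (L k) (L' k) => x y; lia.
  by rewrite subrr sumr_ge0// => k _; case: ifP.
apply: (le_trans (ler_sum _ (fun l _ => step l))).
rewrite exchange_big/= mulr_natl -[X in _ *+ X]card_ord -sumr_const.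
apply: ler_sum => k _; rewrite -big_mkcond/=.
rewrite sumr_const -[_ *+ _]mulr_natl; apply: ler_wpM2r => //.
have -> : #|[pred l : 'I_M | (L' k <= l < L k)%N]| = (L k - L' k)%N.
  rewrite -sum1_card -(big_mkord (fun l => (L' k <= l < L k)%N) (fun=> 1%N)).
  rewrite (big_cat_nat (leq0n _) (LM' k))/=.
  rewrite big1_seq ?add0n; last first.
    by move=> l /andP[/andP[h _]]; rewrite mem_index_iota; lia.
  rewrite (big_cat_nat (LL k) (LM k))/= [X in (_ + X)%N]big1_seq ?addn0.
    rewrite big_nat_cond (eq_bigl (fun l => (L' k <= l < L k)%N && true)).
      by rewrite -big_nat_cond sum_nat_const_nat muln1.
    by move=> l /=; rewrite andbT andbb.
  by move=> l /andP[/andP[_ h]]; rewrite mem_index_iota; lia.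
rewrite ler_pdivlMr// mulrC.
apply: le_trans (height_diff_ge w k (fun i k => proj1 (andP (hh i k))) (LL k)) _.
have hM i j : - ln (lam i j) <= hmax by case/andP: (hh i j).
have /andP[_ h1] : - ln r <= height lam w k (L k) <= - ln r + hmax.
  by apply: height_stopL; rewrite ?r0 ?(le_trans rr').
have /andP[h2 _] : - ln r' <= height lam w k (L' k) <= - ln r' + hmax.
  by apply: height_stopL; rewrite ?r'0.
rewrite ln_div ?posrE//; lra.
Qed.

Lemma mass_mono w r r' : 0 < r -> r <= r' -> mass w r <= mass w r'.
Proof.
move=> r0 rr'; apply: fine_mu_le; try exact: acube_measurable.
move=> v hv l k lk; apply: hv; apply: (leq_trans lk); exact: le_stopL.
Qed.

Definition dyad (j : nat) : R := 2^-1 ^+ j.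

Lemma dyad_gt0 j : 0 < dyad j.
Proof. by rewrite exprn_gt0// invr_gt0. Qed.

Lemma dyadS j : dyad j.+1 = dyad j / 2.
Proof. by rewrite /dyad exprS mulrC. Qed.

Lemma le_dyad a b : (dyad b <= dyad a) = (a <= b)%N.
Proof. by rewrite /dyad ler_iXn2l ?invr_gt0// invf_lt1// ltr1n. Qed.

Lemma dyad_le1 j : dyad j <= 1.
Proof. by rewrite -[1](expr0 2^-1) -/(dyad 0) le_dyad. Qed.

Lemma ln_dyad j : ln (dyad j) = - (ln 2 * j%:R).
Proof.
by rewrite /dyad lnXn ?invr_gt0// lnV ?posrE// mulNrn mulr_natr.
Qed.

Lemma dyad_between (y : R) : 0 < y <= 1 -> exists j, dyad j.+1 < y <= dyad j.
Proof.
move=> /andP[y0 y1].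
have ex : exists j, dyad j < y.
  have h : `|2^-1 : R| < 1 by rewrite ger0_norm ?invr_ge0// invf_lt1// ltr1n.
  have := cvg_expr h; move=> /cvgrPdist_lt/(_ y y0)[n _ hn].
  exists n; have := hn n (leqnn n); rewrite /= sub0r normrN ger0_norm//.
case: (ex_minnP ex) => -[|j] hj jmin.
  by move: hj; rewrite /dyad expr0 ltNge y1.
exists j; rewrite hj leNgt; apply/negP => /jmin; by rewrite ltnn.
Qed.

Lemma dyad_labels w : exists lab : nat -> 'S_d, forall j,
  inA lam (lab j) /\ compat (lab j) (stopL lam w (dyad j)).
Proof.
have [lab hlab] := choice (fun j => compat_exists w (dyad_gt0 j)).
by exists lab.
Qed.

(** The costs are dominated letter by letter by multiples of the height. The summand [hmax] pays for
    the overshoot at the finer scale; in [sum_cost_ge] it is the overshoot at the coarser one. *)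
Lemma sum_cost_le (s : 'S_d) (hmax : R) w r r' (f : 'I_d -> 'I_N.+1) :
  (forall i k, - ln (lam i k) <= hmax) ->
  0 < r -> r <= r' -> r' <= 1 ->
  (forall n : 'I_d, Iset lam t s n.+1 (f n)) ->
  (forall (n : 'I_d) i, Iset lam t s n.+1 i ->
     Defs.ratio lam t p s n i <= Defs.ratio lam t p s n (f n)) ->
  \sum_(n < d) \sum_(stopL lam w r' (s n) <= l < stopL lam w r (s n))
     cond_cost lam t p s n (w l) <=
  (\sum_n Defs.ratio lam t p s n (f n)) * (ln (r' / r) + hmax).
Proof.
move=> hM r0 rr' r1 fI fmax; have r'0 := lt_le_trans r0 rr'.
rewrite mulr_suml; apply: ler_sum => n _.
have LL := le_stopL lam01 w (s n) r0 rr'.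
apply: (@le_trans _ _ (Defs.ratio lam t p s n (f n) *
   (height lam w (s n) (stopL lam w r (s n)) -
    height lam w (s n) (stopL lam w r' (s n))))).
  rewrite (height_diff _ _ _ LL) mulr_sumr; apply: ler_sum => l _.
  exact: (cost_le_ratio finj p1 lam01 fmax).
apply: ler_wpM2l; first by apply: (ratio_ge0 finj p0 p1 _ (fI _)).
have /andP[_ h1] : - ln r <= height lam w (s n) (stopL lam w r (s n)) <= - ln r + hmax.
  by apply: height_stopL; rewrite ?r0 ?(le_trans rr').
have /andP[h2 _] : - ln r' <= height lam w (s n) (stopL lam w r' (s n)) <= - ln r' + hmax.
  by apply: height_stopL; rewrite ?r'0.
rewrite ln_div ?posrE//; lra.
Qed.

Lemma sum_cost_ge (s : 'S_d) (hmax : R) w r r' (f : 'I_d -> 'I_N.+1) :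
  (forall i k, - ln (lam i k) <= hmax) ->
  0 < r -> r <= r' -> r' <= 1 ->
  (forall n : 'I_d, Iset lam t s n.+1 (f n)) ->
  (forall (n : 'I_d) i, Iset lam t s n.+1 i ->
     Defs.ratio lam t p s n (f n) <= Defs.ratio lam t p s n i) ->
  (\sum_n Defs.ratio lam t p s n (f n)) * (ln (r' / r) - hmax) <=
  \sum_(n < d) \sum_(stopL lam w r' (s n) <= l < stopL lam w r (s n))
     cond_cost lam t p s n (w l).
Proof.
move=> hM r0 rr' r1 fI fmin; have r'0 := lt_le_trans r0 rr'.
rewrite mulr_suml; apply: ler_sum => n _.
have LL := le_stopL lam01 w (s n) r0 rr'.
apply: (@le_trans _ _ (Defs.ratio lam t p s n (f n) *
   (height lam w (s n) (stopL lam w r (s n)) -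
    height lam w (s n) (stopL lam w r' (s n))))); last first.
  rewrite (height_diff _ _ _ LL) mulr_sumr; apply: ler_sum => l _.
  exact: (cost_ge_ratio finj p1 lam01 fmin).
apply: ler_wpM2l; first by apply: (ratio_ge0 finj p0 p1 _ (fI _)).
have /andP[h1 _] : - ln r <= height lam w (s n) (stopL lam w r (s n)) <= - ln r + hmax.
  by apply: height_stopL; rewrite ?r0 ?(le_trans rr').
have /andP[_ h2] : - ln r' <= height lam w (s n) (stopL lam w r' (s n)) <= - ln r' + hmax.
  by apply: height_stopL; rewrite ?r'0.
rewrite ln_div ?posrE//; lra.
Qed.

Lemma ln_dyad_ratio a b : (a <= b)%N -> ln (dyad a / dyad b) = ln 2 * (b - a)%:R.
Proof.
move=> ab; rewrite ln_div ?posrE ?dyad_gt0// !ln_dyad natrB//; ring.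
Qed.

Lemma growth_upper (S : R) : 0 <= S ->
  (forall s, inA lam s -> (Sbar lam t p s <= S%:E)%E) ->
  exists C : R, forall w a b, (a <= b)%N ->
    - ln (mass w (dyad b)) - - ln (mass w (dyad a)) <=
    S * ln (dyad a / dyad b) + C.
Proof.
move=> S0 hS; have [hmin [hmax [hm0 hh]]] := nln_lam_bounds lam01.
have hM i k : - ln (lam i k) <= hmax by case/andP: (hh i k).
have hM0 : 0 <= `|hmax| by [].
have [pm pm0 hp] := fin_family_lbound p0.
(* The first summand covers two scales with the same ordering, the second a step to the next dyadic
   scale whatever the orderings; absolute values make [K] visibly nonnegative. *)
pose K := S * `|hmax| + `|d%:R * ((ln 2 + hmax) / hmin * - ln pm)|.
have K0 : 0 <= K by rewrite addr_ge0// mulr_ge0.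
have ln20 : 0 <= ln (2 : R) by rewrite ln_ge0// ler1n.
exists (2 * K * #|{: 'S_d}|%:R) => w a b ab.
rewrite ln_dyad_ratio// mulrA.
have [lab hlab] := dyad_labels w.
apply: (labelled_growth (lab := lab) (g := fun j => - ln (mass w (dyad j)))) => //.
  move=> i j ij lij; have [iA ic] := hlab i; have [_] := hlab j.
  rewrite -lij => jc.
  rewrite (nln_mass_diff _ _ jc ic) ?dyad_gt0 ?le_dyad//.
  have [f [fI fE fmax]] := SbarP lam t (lab i) p.
  have fS : \sum_n Defs.ratio lam t p (lab i) n (f n) <= S.
    by rewrite -lee_fin -fE hS.
  apply: le_trans (sum_cost_le w hM (dyad_gt0 j) _ (dyad_le1 _) fI fmax) _.
    by rewrite le_dyad.
  rewrite ln_dyad_ratio// -mulrA.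
  have hx : 0 <= ln 2 * (j - i)%:R :> R by rewrite mulr_ge0.
  have hh1 : hmax <= `|hmax| := ler_norm _.
  have hr : 0 <= \sum_n Defs.ratio lam t p (lab i) n (f n).
    by apply: sumr_ge0 => n _; apply: (ratio_ge0 finj p0 p1 _ (fI _)).
  rewrite /K addrA ler_wpDr// -mulrDr.
  apply: (@le_trans _ _ ((\sum_n Defs.ratio lam t p (lab i) n (f n)) * (ln 2 * (j - i)%:R + `|hmax|))).
    by rewrite ler_wpM2l// lerD2l.
  by rewrite ler_wpM2r// addr_ge0.
move=> j; apply: le_trans (nln_mass_adj hm0 hh pm0 hp w (dyad_gt0 _) _ (dyad_le1 _)) _.
  by rewrite le_dyad.
rewrite ln_dyad_ratio// subSnn mulr1 /K addrA ler_wpDl ?ler_norm// addr_ge0//.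
  by rewrite mulr_ge0.
by rewrite mulr_ge0.
Qed.

Lemma growth_lower (S : R) : 0 <= S ->
  (forall s, inA lam s -> (S%:E <= Sunder lam t p s)%E) ->
  exists C : R, forall w a b, (a <= b)%N ->
    S * ln (dyad a / dyad b) - C <=
    - ln (mass w (dyad b)) - - ln (mass w (dyad a)).
Proof.
move=> S0 hS; have [hmin [hmax [hm0 hh]]] := nln_lam_bounds lam01.
have hM i k : - ln (lam i k) <= hmax by case/andP: (hh i k).
have ln20 : 0 <= ln (2 : R) by rewrite ln_ge0// ler1n.
have Tub := fin_family_ubound (fun s : 'S_d => fine (Sunder lam t p s)).
have [B B0 hB] := Tub.
(* The overshoot is multiplied by the sum for the current ordering, which [S] bounds only from
   below; hence [B]. In a single step only monotonicity of the mass is used, and [S * ln 2] makes up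
   for the missing growth. *)
pose K := B * `|hmax| + S * ln 2.
have K0 : 0 <= K by rewrite addr_ge0// mulr_ge0// ltW.
exists (2 * K * #|{: 'S_d}|%:R) => w a b ab.
rewrite ln_dyad_ratio// mulrA.
have [lab hlab] := dyad_labels w.
suff : - - ln (mass w (dyad b)) - - - ln (mass w (dyad a)) <=
    - (S * ln 2) * (b - a)%:R + 2 * K * #|{: 'S_d}|%:R by lra.
apply: (labelled_growth (lab := lab) (g := fun j => - - ln (mass w (dyad j)))) => //.
  move=> i j ij lij; have [iA ic] := hlab i; have [_] := hlab j.
  rewrite -lij => jc.
  have := nln_mass_diff (dyad_gt0 j) _ jc ic; rewrite le_dyad => /(_ ij) E.
  have [f [fI fE fmin]] := SunderP lam t (lab i) p.
  have fS : S <= \sum_n Defs.ratio lam t p (lab i) n (f n).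
    by rewrite -lee_fin -fE hS.
  have fB : \sum_n Defs.ratio lam t p (lab i) n (f n) <= B.
    by have := hB (lab i); rewrite fE.
  have := sum_cost_ge w hM (dyad_gt0 j) _ (dyad_le1 _) fI fmin.
  move=> /(_ i); rewrite le_dyad => /(_ ij); rewrite -E ln_dyad_ratio//.
  set x := _ * (j - i)%:R; move: fS fB; set F := \sum_n _ => fS fB h.
  have x0 : 0 <= x by rewrite mulr_ge0.
  have : S * x <= F * x by rewrite ler_wpM2r.
  have : F * hmax <= B * `|hmax|.
    apply: (@le_trans _ _ (F * `|hmax|)); first by rewrite ler_wpM2l ?ler_norm// (le_trans S0).
    by rewrite ler_wpM2r.
  have : 0 <= S * ln 2 by rewrite mulr_ge0.
  rewrite /K mulNr -mulrA -/x; move: h; rewrite mulrBr; lra.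
move=> j; have := mass_mono w (dyad_gt0 j.+1) (_ : dyad j.+1 <= dyad j).
rewrite le_dyad leqnSn => /(_ isT).
rewrite -ler_ln ?posrE ?mass_gt0// /K => h.
have : 0 <= B * `|hmax| by rewrite mulr_ge0// ltW.
lra.
Qed.

End Growth.

(** * Words with prescribed crossing windows *)

Section BlockWords.
Variables (T : Type) (v : seq T) (A K : nat -> nat) (x : nat -> T).

Definition prevA (m : nat) : nat := if m is m'.+1 then A m' else 0.

(** [A m] counts all copies of [v] before the block of [x m], so only the difference to the previous
    count is appended. *)
Fixpoint blockw (m : nat) : seq T :=
  if m is m'.+1 then
    (blockw m' ++ flatten (nseq (A m' - prevA m') v)) ++ nseq (K m') (x m')
  else [::].

Definition prew (m : nat) : seq T :=
  blockw m ++ flatten (nseq (A m - prevA m) v).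

Lemma blockw_prefix m m' : (m <= m')%N ->
  exists rest, blockw m' = blockw m ++ rest.
Proof.
elim: m' => [|m' IH]; first by rewrite leqn0 => /eqP->; exists [::].
rewrite leq_eqVlt => /orP[/eqP->|]; first by exists [::]; rewrite cats0.
rewrite ltnS => /IH[rest e]; rewrite /= e -!catA; eexists; reflexivity.
Qed.

Variables (R : realType) (g : T -> R).

Lemma sum_flatten_nseq c :
  \sum_(i <- flatten (nseq c v)) g i = c%:R * \sum_(i <- v) g i.
Proof.
elim: c => [|c IH] /=; first by rewrite big_nil mul0r.
by rewrite big_cat/= IH -natr1 mulrDl mul1r addrC.
Qed.

Lemma sum_nseq c i : \sum_(j <- nseq c i) g j = c%:R * g i.
Proof.
elim: c => [|c IH] /=; first by rewrite big_nil mul0r.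
by rewrite big_cons IH -natr1 mulrDl mul1r addrC.
Qed.

(** Monotonicity of [A] makes the truncated differences genuine, so that they telescope to the last
    count. *)
Lemma sum_blockw m : (forall j, (j < m)%N -> (prevA j <= A j)%N) ->
  \sum_(i <- blockw m) g i =
  (prevA m)%:R * \sum_(i <- v) g i + \sum_(j < m) (K j)%:R * g (x j).
Proof.
elim: m => [|m IH] hA; first by rewrite /= big_nil big_ord0 mul0r addr0.
rewrite /= !big_cat/= sum_flatten_nseq sum_nseq IH; last first.
  by move=> j jm; apply: hA; rewrite ltnS ltnW.
by rewrite big_ord_recr/= natrB ?hA//; ring.
Qed.

Lemma sum_prew m : (forall j, (j <= m)%N -> (prevA j <= A j)%N) ->
  \sum_(i <- prew m) g i =
  (A m)%:R * \sum_(i <- v) g i + \sum_(j < m) (K j)%:R * g (x j).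
Proof.
move=> hA; rewrite big_cat/= sum_flatten_nseq sum_blockw; last first.
  by move=> j jm; apply: hA; exact: ltnW.
by rewrite natrB ?hA//; ring.
Qed.

End BlockWords.

Lemma height_prefix (R : realType) (d N : nat) (lam : 'I_N.+1 -> 'I_d -> R)
    (u rest : seq 'I_N.+1) (k : 'I_d) :
  height lam (nth ord0 (u ++ rest)) k (size u) = \sum_(i <- u) - ln (lam i k).
Proof.
rewrite (big_nth ord0) big_mkord; apply: eq_bigr => l _.
by rewrite nth_cat ltn_ord.
Qed.

Lemma trunc_multiple (R : realType) (y h : R) : 0 <= y -> 0 < h ->
  exists c : nat, y <= c%:R * h <= y + h.
Proof.
move=> y0 h0; exists (Num.trunc (y / h)).+1.
have /andP[h1 h2] := truncn_itv (divr_ge0 y0 (ltW h0)).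
by rewrite -ler_pdivrMr// ltW//= -natr1 mulrDl mul1r lerD2r -ler_pdivlMr.
Qed.

Lemma pred_sub_ltn d n : (0 < d)%N -> (d.-1 - n < d)%N.
Proof. lia. Qed.

Lemma pred_sub_ltn2 d a b : (a < b)%N -> (b < d)%N -> (d.-1 - b < d.-1 - a)%N.
Proof. lia. Qed.

Lemma pred_subK d n : (n < d)%N -> (d.-1 - (d.-1 - n) = n)%N.
Proof. lia. Qed.

Section Windows.
Variables (R : realType) (d N : nat) (lam : 'I_N.+1 -> 'I_d -> R).
Hypothesis lam01 : forall i n, 0 < lam i n < 1.
Hypothesis d0 : (0 < d)%N.

Lemma inB_word s : inB lam s -> exists v : seq 'I_N.+1,
  forall a b : 'I_d, 0 < \sum_(i <- v) - ln (lam i (s a)) /\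
  ((a < b)%N -> \sum_(i <- v) - ln (lam i (s a)) < \sum_(i <- v) - ln (lam i (s b))).
Proof.
move=> [w [r [r0 [k [L [kd [/andP[h1 h2] hs]]]]]]].
(* Since [L.-1] is 0 for [L = 0], stopping there would mean [1 <= r < 1]. *)
have L0 : (0 < L)%N.
  by case: L h1 h2 {hs} => // h1 h2; have := le_lt_trans h1 h2; rewrite ltxx.
exists [seq w l | l <- iota 0 L] => a b.
have E (j : 'I_d) :
    \sum_(i <- [seq w l | l <- iota 0 L]) - ln (lam i j) = height lam w j L.
  by rewrite big_map -{1}[L]subn0 -/(index_iota 0 L) big_mkord.
rewrite !E; split.
  apply: lt_le_trans (le_height lam01 w (s a) L0).
  by rewrite heightS height0 sub0r nln_lam_gt0.
by move=> /hs; rewrite !(heightE lam01) ltrN2 ltr_ln ?posrE ?prodL_gt0.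
Qed.

(* The word is v^A x_0^K v^A' x_1^K' ..., the m-th block x_m^K sitting where
   the m-th coordinate from the end crosses the scales between r' and r.  The
   repetitions of v, whose contraction ratios are strictly ordered by s, keep
   these places apart once r' is small enough. *)
Lemma windows s : inB lam s -> exists D : nat, forall (ii : 'I_d -> 'I_N.+1) (tau X : R),
  0 < tau -> exists w (r r' : R) (a K : 'I_d -> nat),
  [/\ 0 < r < r', r' <= expR (- X), ln (r' / r) = tau,
      (forall a b : 'I_d, (a < b)%N ->
         (stopL lam w r' (s b) < stopL lam w r' (s a))%N /\
         (stopL lam w r (s b) < stopL lam w r (s a))%N) &
   forall n : 'I_d,
   [/\ forall l, (a n <= l < a n + K n)%N -> w l = ii n,
       (stopL lam w r' (s n) <= a n <= stopL lam w r' (s n) + D)%N,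
       (stopL lam w r (s n) <= a n + K n <= stopL lam w r (s n) + D)%N &
       `|(K n)%:R * - ln (lam (ii n) (s n)) - tau| <= D%:R]].
Proof.
move=> /inB_word[v hv]; have [hmin [hmax [hm0 hh]]] := nln_lam_bounds lam01.
have hm i k : hmin <= - ln (lam i k) by case/andP: (hh i k).
have hM i k : - ln (lam i k) <= hmax by case/andP: (hh i k).
have hM0 : 0 <= hmax by rewrite (le_trans (ltW hm0))// (le_trans (hm ord0 (Ordinal d0))).
pose V n := \sum_(i <- v) - ln (lam i (s n)).
have V0 n : 0 < V n by case: (hv n n).
have Vlt (a b : 'I_d) : (a < b)%N -> V a < V b by case: (hv a b).
have [VM VM0 hVM] := fin_family_ubound V.
pose gp (ab : 'I_d * 'I_d) := if (ab.1 < ab.2)%N then V ab.2 - V ab.1 else 1.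
have [|gm gm0 hgm] := @fin_family_lbound R _ gp.
  by move=> [a b]; rewrite /gp/=; case: ifP => // /Vlt; rewrite subr_gt0.
have Vgap (a b : 'I_d) : (a < b)%N -> gm <= V b - V a.
  by move=> ab; have := hgm (a, b); rewrite /gp/= ab.
(* A window may start late by one copy of [v] and end late by that and one more letter: a height of
   at most [VM + hmax], or [(VM + hmax) / hmin] letters. The extra [hmax] bounds the rounding of the
   block to whole letters. *)
pose D := (Num.trunc (hmax + (VM + hmax) / hmin)).+1.
have DD : hmax + (VM + hmax) / hmin <= D%:R.
  have q0 : 0 <= hmax + (VM + hmax) / hmin.
    by rewrite addr_ge0// divr_ge0 ?addr_ge0// ltW.
  by have /andP[_ /ltW] := truncn_itv q0.
have D1 : hmax <= D%:R.
  by rewrite (le_trans _ DD)// lerDl divr_ge0 ?addr_ge0// ltW.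
have D2 : VM + hmax <= hmin * D%:R.
  by rewrite mulrC -ler_pdivrMr// (le_trans _ DD)// lerDr.
exists D => ii tau X tau0.
(* Coordinates late in [s] gain most height per copy of [v] and reach a given level first, so
   windows are numbered from the last coordinate. *)
pose o (m : nat) : 'I_d := odflt (Ordinal d0) (insub (d.-1 - m)%N).
have oE m : (m < d)%N -> nat_of_ord (o m) = (d.-1 - m)%N.
  by move=> md; rewrite /o insubT//=; exact: pred_sub_ltn.
have oK (n : 'I_d) : o (d.-1 - n)%N = n.
  by apply: val_inj; rewrite /= oE ?pred_subK ?pred_sub_ltn.
have oV m m' : (m < m')%N -> (m' < d)%N -> (o m' < o m)%N.
  by move=> mm md; rewrite !oE ?pred_sub_ltn2// (ltn_trans mm).
pose x m := ii (o m).
have [K hK] : exists K : nat -> nat, forall m,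
    tau <= (K m)%:R * - ln (lam (x m) (s (o m))) <= tau + hmax.
  have H m : exists c : nat,
      tau <= c%:R * - ln (lam (x m) (s (o m))) <= tau + hmax.
    have [c /andP[c1 c2]] := trunc_multiple (ltW tau0) (nln_lam_gt0 lam01 (x m) (s (o m))).
    by exists c; rewrite c1/= (le_trans c2)// lerD2l.
  by have [K hK] := choice H; exists K.
pose En m k := \sum_(j < m) (K j)%:R * - ln (lam (x j) k).
have En0 m k : 0 <= En m k.
  by apply: sumr_ge0 => j _; rewrite mulr_ge0// ltW// nln_lam_gt0.
have EnS m k : En m k <= En m.+1 k.
  by rewrite /En big_ord_recr/= lerDl mulr_ge0// ltW// nln_lam_gt0.
have Ele m k : (m <= d)%N -> En m k <= En d k.
  have h : {homo (fun m => En m k) : a b / (a <= b)%N >-> a <= b}.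
    apply: homo_leq => [//|b a c|a]; [exact: le_trans|exact: EnS].
  exact: h.
have [EM EM0 hEM] := fin_family_ubound (En d).
have EnM m k : (m <= d)%N -> En m k <= EM by move=> /Ele/le_trans; apply.
(* [T] is the level of [r']. It is so large that the gap [gm] between the growth rates outweighs one
   surplus copy of [v] and all inserted blocks, whose total height is at most [EM]; this gives [far]
   below. *)
pose T := Num.max (Num.max 0 X) (EM + VM * (VM + EM) / gm + 1).
have TX : X <= T by rewrite !le_max lexx orbT.
have T0 : 0 <= T by rewrite !le_max lexx.
have T1 : EM + VM * (VM + EM) / gm + 1 <= T by rewrite le_max lexx orbT.
have q0 : 0 <= VM * (VM + EM) / gm.
  by rewrite divr_ge0 ?mulr_ge0 ?addr_ge0// ltW.
have TE : EM <= T by lra.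
have TG : VM * (VM + EM) < T * gm by rewrite -ltr_pdivrMr//; lra.
(* Enough copies of [v] to bring coordinate [o m] to level [T], the earlier blocks included, with a
   surplus of at most one copy. *)
have [A hA] : exists A : nat -> nat, forall m, (m < d)%N ->
    T <= (A m)%:R * V (o m) + En m (s (o m)) <= T + V (o m).
  have H m : exists c : nat, (m < d)%N ->
      T <= c%:R * V (o m) + En m (s (o m)) <= T + V (o m).
    case: (boolP (m < d)%N) => md; last by exists 0%N.
    have y0 : 0 <= T - En m (s (o m)).
      by rewrite subr_ge0 (le_trans _ TE)// EnM// ltnW.
    have [c /andP[c1 c2]] := trunc_multiple y0 (V0 (o m)).
    exists c => _; apply/andP; split; lra.
  by have [A hA] := choice H; exists A.
have far m m' : (m < m')%N -> (m' < d)%N -> (A m)%:R * V (o m') + EM < T.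
  move=> mm md; have md' := ltn_trans mm md.
  have /andP[_ h1] := hA m md'; have h2 := En0 m (s (o m)).
  have h3 := Vgap _ _ (oV _ _ mm md).
  have h4 := V0 (o m); have h5 := V0 (o m').
  have h6 := hVM (o m); have h7 := hVM (o m').
  have h8 : (A m)%:R * V (o m) <= T + V (o m) by lra.
  rewrite -(ltr_pM2r h4).
  have h9 : (A m)%:R * V (o m) * V (o m') <= (T + V (o m)) * V (o m').
    by rewrite ler_wpM2r// ltW.
  have h10 : T * gm <= T * (V (o m) - V (o m')) by rewrite ler_wpM2l.
  have h11 : V (o m) * (V (o m') + EM) <= VM * (VM + EM).
    by rewrite ler_pM ?lerD2r ?addr_ge0// ltW.
  nra.
have Amono m m' : (m <= m')%N -> (m' < d)%N -> (A m <= A m')%N.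
  rewrite leq_eqVlt => /orP[/eqP->//|mm md].
  have h := far _ _ mm md; have /andP[h1 _] := hA m' md.
  rewrite -(ler_nat R) -(ler_pM2r (V0 (o m'))).
  have := EnM m' (s (o m')) (ltnW md); lra.
have Aprev j : (j < d)%N -> (prevA A j <= A j)%N.
  by case: j => [//|j] jd; exact: Amono.
pose W := blockw v A K x d; pose w : Sigma N := nth ord0 W.
pose pm (n : 'I_d) := (d.-1 - nat_of_ord n)%N.
have pmd (n : 'I_d) : (pm n < d)%N by exact: pred_sub_ltn.
have pmo (n : 'I_d) : o (pm n) = n by exact: oK.
have pmlt (a b : 'I_d) : (a < b)%N -> (pm b < pm a)%N.
  by move=> ab; exact: pred_sub_ltn2.
pose a (n : 'I_d) := size (prew v A K x (pm n)).
have Wsplit m : (m < d)%N -> exists rest,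
    W = (prew v A K x m ++ nseq (K m) (x m)) ++ rest.
  by move=> /(blockw_prefix v A K x)[rest e]; exists rest; exact: e.
have hta k n : height lam w k (a n) =
    (A (pm n))%:R * (\sum_(i <- v) - ln (lam i k)) + En (pm n) k.
  have [rest e] := Wsplit _ (pmd n).
  rewrite /w e -catA height_prefix sum_prew// => j jm; apply: Aprev.
  exact: leq_ltn_trans jm (pmd n).
have htb k n : height lam w k (a n + K (pm n)) =
    (A (pm n))%:R * (\sum_(i <- v) - ln (lam i k)) + En (pm n).+1 k.
  have [rest e] := Wsplit _ (pmd n).
  have -> : (a n + K (pm n))%N = size (prew v A K x (pm n) ++ nseq (K (pm n)) (x (pm n))).
    by rewrite size_cat size_nseq.
  rewrite /w e height_prefix big_cat/= sum_prew; last first.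
    by move=> j jm; apply: Aprev; exact: leq_ltn_trans jm (pmd n).
  by rewrite sum_nseq /En big_ord_recr/= addrA.
pose r' := expR (- T); pose r := expR (- (T + tau)).
have r'0 : 0 < r' := expR_gt0 _; have r0 : 0 < r := expR_gt0 _.
have lr' : - ln r' = T by rewrite expRK opprK.
have lr : - ln r = T + tau by rewrite expRK opprK.
have hAn n := hA _ (pmd n).
have Ra n : (stopL lam w r' (s n) <= a n)%N.
  rewrite stopL_le_height// lr' hta; have := hAn n; rewrite pmo.
  by case/andP.
have hKn n : tau <= (K (pm n))%:R * - ln (lam (ii n) (s n)) <= tau + hmax.
  by have := hK (pm n); rewrite /x pmo.
have ra n : (stopL lam w r (s n) <= a n + K (pm n))%N.
  rewrite stopL_le_height// lr htb; have := hAn n; rewrite pmo => /andP[h1 _].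
  rewrite /En big_ord_recr/= addrA lerD//.
  by rewrite /x pmo; have /andP[] := hKn n.
(* The window of [c] is over before an earlier coordinate [b] of [s] reaches level [T]; strict order
   of the stopping times at both scales follows. *)
have Rfar (b c : 'I_d) : (b < c)%N -> (a c + K (pm c) < stopL lam w r' (s b))%N.
  move=> bc; rewrite lt_stopL_height// lr' htb.
  have := far _ _ (pmlt _ _ bc) (pmd b); rewrite pmo.
  apply: le_lt_trans; rewrite lerD2l; apply: EnM; exact: pmd.
have rr' : r < r' by rewrite ltr_expR ltrN2 ltrDl.
have LL k : (stopL lam w r' k <= stopL lam w r k)%N.
  by apply: le_stopL => //; exact: ltW.
exists w, r, r', a, (fun n => K (pm n)); split.
- by rewrite r0.
- by rewrite ler_expR lerN2.
- by rewrite ln_div ?posrE// /r /r' !expRK; ring.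
- move=> b c bc; have h := Rfar _ _ bc; split.
    by apply: leq_ltn_trans h; apply: leq_trans (Ra c) (leq_addr _ _).
  by apply: leq_trans (LL (s b)); apply: leq_ltn_trans h; exact: ra.
move=> n; split.
- move=> l /andP[l1 l2]; have [rest e] := Wsplit _ (pmd n).
  rewrite /w e nth_cat size_cat size_nseq l2 nth_cat ltnNge l1/= nth_nseq.
  by rewrite ltn_subLR// l2 /x pmo.
- rewrite Ra/= -leq_subLR -(ler_nat R) -(ler_pM2l hm0).
  apply: le_trans (height_diff_ge w (s n) hm (Ra n)) _.
  apply: le_trans D2; rewrite hta.
  have := stopL_le_height lam01 w (s n) (stopL lam w r' (s n)) r'0.
  rewrite leqnn lr' => /esym h; have := hAn n; rewrite pmo => /andP[_].
  rewrite -/(V n); have := hVM n; lra.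
- rewrite ra/= -leq_subLR -(ler_nat R) -(ler_pM2l hm0).
  apply: le_trans (height_diff_ge w (s n) hm (ra n)) _.
  apply: le_trans D2; rewrite htb /En big_ord_recr/= {2}/x pmo.
  have := stopL_le_height lam01 w (s n) (stopL lam w r (s n)) r0.
  rewrite leqnn lr => /esym h; have := hAn n; rewrite pmo => /andP[_].
  rewrite -/(V n) -/(En _ _); have := hVM n; have := hKn n; lra.
- have := hKn n => /andP[h1 h2]; rewrite ger0_norm ?subr_ge0//.
  by rewrite lerBlDl (le_trans h2)// lerD2l.
Qed.

End Windows.

(** * The coordinate-wise natural measure *)

Lemma continuous_big_sum (R : realType) (J : Type) (r : seq J) (P : pred J)
    (g : J -> R -> R) : (forall j, continuous (g j)) ->
  continuous (fun x => \sum_(j <- r | P j) g j x).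
Proof.
move=> cg; elim: r => [|j r IH] x.
  under eq_fun do rewrite big_nil; exact: cvg_cst.
under eq_fun do rewrite big_cons.
case: (P j); last exact: IH.
by apply: cvgD; [exact: cg|exact: IH].
Qed.

(** Intermediate values: at 0 the sum is the number [n1] of terms, and at [x0] each term is at most
    [n1^-1]. *)
Lemma moran_exponent_exists (R : realType) (J : finType) (P : pred J) (l : J -> R)
    (j0 : J) : (forall j, 0 < l j < 1) -> P j0 ->
  exists x : R, \sum_(j | P j) powR (l j) x = 1.
Proof.
move=> l01 Pj0; pose f x := \sum_(j | P j) powR (l j) x.
have nl j : 0 < - ln (l j) by rewrite oppr_gt0 ln_lt0.
have l0 j : 0 < l j by case/andP: (l01 j).
have powE j y : powR (l j) y = expR (y * ln (l j)) by rewrite /powR gt_eqF.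
have [hm hm0 hhm] := fin_family_lbound nl.
have cf : continuous f.
  apply: continuous_big_sum => j x.
  rewrite (_ : (fun y => _) = expR \o (fun y => y * ln (l j))); last first.
    by apply/funext => y /=; rewrite powE.
  apply: continuous_comp; last exact: continuous_expR.
  exact: mulrr_continuous.
pose n1 : R := #|P|%:R.
have n10 : 1 <= n1 by rewrite ler1n; apply/card_gt0P; exists j0.
pose x0 := ln n1 / hm.
have x00 : 0 <= x0 by rewrite divr_ge0 ?ln_ge0// ltW.
have f0 : 1 <= f 0.
  rewrite /f (eq_bigr (fun=> 1)); last by move=> j _; rewrite powRr0.
  by rewrite sumr_const.
have f1 : f x0 <= 1.
  apply: (@le_trans _ _ (\sum_(j | P j) n1^-1)).
    apply: ler_sum => j _; rewrite powE.
    rewrite -[n1^-1]lnK ?posrE ?invr_gt0 ?(lt_le_trans ltr01)// ler_expR.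
    rewrite lnV ?posrE ?(lt_le_trans ltr01)// -[X in X <= _]opprK lerN2 -mulrN.
    by rewrite /x0 mulrAC ler_pdivlMr// ler_wpM2l ?ln_ge0.
  by rewrite sumr_const -[n1^-1 *+ _]mulr_natr mulVf// gt_eqF// (lt_le_trans ltr01).
have [||x _ fx] := @IVT R f 0 x0 1 x00.
- exact: continuous_subspaceT.
- by rewrite ge_min f1 orbT le_max f0.
- by exists x.
Qed.

Section NaturalMeasure.
Variables (R : realType) (d N : nat) (lam t : 'I_N.+1 -> 'I_d -> R).
Hypothesis lam01 : forall i n, 0 < lam i n < 1.
Hypothesis finj : forall i j, i != j ->
     ~ (forall x, unit_cube x -> ifs_map lam t i x = ifs_map lam t j x).
Variable s : 'S_d.
Implicit Types (i j : 'I_N.+1).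

Local Notation ov := (ovb lam t s).
Local Notation Iset := (Iset lam t s).
Local Notation projidx := (projidx lam t s).
Local Notation q := (qnat lam t s).
Local Notation cmass := (class_mass lam t q s).

(** This is $s_n^s(\Pi_n^s i)$ as a function of every letter, level 0 included. *)
Definition natexp (n : 'I_d) i : R :=
  sexp lam t s n (if nat_of_ord n == 0%N then None else Some (projidx n i)).

Lemma natexp_ov (n : 'I_d) i j : ov n i j -> natexp n i = natexp n j.
Proof.
by move=> o; rewrite /natexp; case: ifP => // _; congr (sexp _ _ _ _ (Some _));
  apply/eqP; rewrite (projidx_eq finj).
Qed.

Lemma natexpP (n : 'I_d) i0 :
  \sum_(j | `[< Iset n.+1 j >] && ov n j i0) powR (lam j (s n)) (natexp n i0) = 1.
Proof.
pose P j := `[< Iset n.+1 j >] && ov n j i0.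
have [||x hx] := @moran_exponent_exists R _ P (fun j => lam j (s n)) (projidx n.+1 i0).
- by move=> j; exact: lam01.
- rewrite /P (ov_le (leqnSn n) (ov_projidx lam t s n.+1 i0)) andbT.
  by apply/asboolP; exact: Iset_projidx.
pose oi := if nat_of_ord n == 0%N then None else Some (projidx n i0).
pose Q j := `[< Iset n.+1 j >] &&
   match oi with None => true | Some i => projidx n j == i end.
have PQ : P =1 Q.
  move=> j; rewrite /P /Q /oi; case: ifPn => [/eqP->|_]; first by rewrite ov0.
  by rewrite (projidx_eq finj).
rewrite (eq_bigl _ _ PQ) /natexp /sexp -/oi.
apply: (xgetPex 0 (P := [set x | \sum_(j | Q j) powR (lam j (s n)) x = 1])).
by exists x => /=; rewrite -(eq_bigl _ _ PQ).
Qed.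

(** The first [n] factors of [qnat], with the ratios read off [i] itself instead of its
    representatives. *)
Definition natprod (n : nat) i : R :=
  \prod_(m < d | (m < n)%N) powR (lam i (s m)) (natexp m i).

Lemma natprod_gt0 n i : 0 < natprod n i.
Proof. by apply: prodr_gt0 => m _; rewrite powR_gt0// (lam_gt0 lam01). Qed.

Lemma natprod_ov n i j : ov n i j -> natprod n i = natprod n j.
Proof.
move=> o; apply: eq_bigr => m mn.
by rewrite (ov_lam (ov_le mn o)) (natexp_ov (ov_le (ltnW mn) o)).
Qed.

Lemma natprodS (n : 'I_d) i :
  natprod n.+1 i = natprod n i * powR (lam i (s n)) (natexp n i).
Proof.
rewrite /natprod (bigD1 n) //= mulrC; congr (_ * _); apply: eq_bigl => m.
rewrite ltnS [in RHS]ltn_neqAle andbC; congr (_ && _).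
Qed.

Lemma qnatE i : q i = natprod d i.
Proof.
rewrite /qnat /natprod; apply: eq_big => [n|n _]; first by rewrite ltn_ord.
by rewrite (ov_lam (ov_projidx lam t s n.+1 i)).
Qed.

(** Downward induction from [d], where classes are singletons. A class of level [m] splits into
    classes of level [m.+1], and the equation defining the exponent sums their last factors to 1. *)
Lemma cmass_natprod n i : (n <= d)%N -> cmass n i = natprod n i.
Proof.
move=> nd; rewrite -(subKn nd); move: (d - n)%N (leq_subr n d) => e ed.
elim: e ed i => [|e IH] ed i.
  rewrite subn0 /class_mass (bigD1 i) ?ov_refl//= big1 ?addr0 ?qnatE//.
  by move=> j /andP[/(ov_full finj) ->]; rewrite eqxx.
pose m := (d - e.+1)%N; have md : (m < d)%N by rewrite /m; lia.
have mS : (d - e = m.+1)%N by rewrite /m; lia.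
rewrite -/m; pose n' : 'I_d := Ordinal md.
rewrite /class_mass (partition_big (projidx m.+1)
   (fun i' => `[< Iset m.+1 i' >] && ov m i' i)) /=; last first.
  move=> j oj; apply/andP; split; first by apply/asboolP; exact: Iset_projidx.
  by apply: ov_trans oj; apply: (ov_le (leqnSn m)); exact: ov_projidx.
rewrite -[RHS]mulr1 -(natexpP n' i) mulr_sumr; apply: eq_bigr => i' /andP[/asboolP Ii' oi'].
have -> : \sum_(j | ov m j i && (projidx m.+1 j == i')) q j = cmass m.+1 i'.
  apply: eq_bigl => j.
  have -> : (projidx m.+1 j == i') = ov m.+1 j i'.
    by rewrite -{1}(projidx_id finj Ii') (projidx_eq finj).
  apply/andP/idP => [[]//|o]; split=> //.
  by apply: ov_trans oi'; apply: ov_le o.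
rewrite -mS IH ?mS; last by lia.
rewrite -[m.+1]/(n'.+1) natprodS.
by rewrite (natprod_ov (n := n') oi') (natexp_ov (n := n') oi').
Qed.

Lemma pmass_natprod n i : (n <= d)%N ->
  pmass lam t q s n (projidx n i) = natprod n i.
Proof.
case: n => [_|n nd]; first by rewrite /natprod /pmass /= big_pred0.
by rewrite (pmass_cmass finj)// cmass_natprod.
Qed.

Lemma ratio_qnat (n : 'I_d) i : Iset n.+1 i ->
  Defs.ratio lam t q s n i = natexp n i.
Proof.
move=> Ii; rewrite /Defs.ratio /Pcond/= -{1}(projidx_id finj Ii).
rewrite !pmass_natprod ?(ltnW (ltn_ord n))// natprodS mulrAC divff; last first.
  by rewrite gt_eqF// natprod_gt0.
have l0 := lam_gt0 lam01 i (s n).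
have nl : ln (lam i (s n)) != 0 by rewrite lt_eqF// ln_lt0.
by rewrite mul1r ln_powR mulfK.
Qed.

Lemma natexp_Some (n : 'I_d) i : (0 < n)%N -> Iset n i ->
  natexp n i = sexp lam t s n (Some i).
Proof. by move=> n0 Ii; rewrite /natexp gtn_eqF// (projidx_id finj). Qed.

(** The ratios are maximised over $I_{n+1}^s$ and the exponents over $I_n^s$. The values agree
    because [natexp n] depends only on the class at level [n] and, for [0 < n], $I_n^s$ is contained
    in $I_{n+1}^s$. *)
Lemma Sbar_qnat (k0 : 'I_d) : nat_of_ord k0 = 0%N ->
  Sbar lam t q s = ((sexp lam t s k0 None)%:E
     + \sum_(n < d | (0 < n)%N)
         \big[maxe/-oo%E]_(i : 'I_N.+1 | `[< Iset n i >])
            (sexp lam t s n (Some i))%:E)%E.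
Proof.
move=> k00; rewrite /Sbar (bigD1 k0)//=; congr (_ + _)%E.
  have [j Ij] := Iset_exists lam t s k0.+1.
  apply/eqP; rewrite eq_le; apply/andP; split.
    apply/bigmax_leP; split=> [|i /asboolP Ii]; first exact: leNye.
    by rewrite ratio_qnat// /natexp k00.
  have <- : Defs.ratio lam t q s k0 j = sexp lam t s k0 None.
    by rewrite ratio_qnat// /natexp k00.
  by apply: (le_bigmax_cond _ (fun i => (Defs.ratio lam t q s k0 i)%:E)); exact/asboolP.
apply: eq_big => [n|n n0].
  by rewrite lt0n -k00.
have {}n0 : (0 < n)%N by rewrite lt0n -k00; exact: n0.
apply/eqP; rewrite eq_le; apply/andP; split; apply/bigmax_leP; split=> [|i /asboolP Ii];
  try exact: leNye.
  rewrite ratio_qnat// /natexp gtn_eqF//.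
  apply: (le_bigmax_cond _ (fun i => (sexp lam t s n (Some i))%:E)).
  by apply/asboolP; exact: Iset_projidx.
have Ii' : Iset n.+1 i by apply: Iset_le Ii => //; exact: ltn_ord.
rewrite -natexp_Some// -ratio_qnat//.
by apply: (le_bigmax_cond _ (fun i => (Defs.ratio lam t q s n i)%:E)); exact/asboolP.
Qed.

Lemma Sunder_qnat (k0 : 'I_d) : nat_of_ord k0 = 0%N ->
  Sunder lam t q s = ((sexp lam t s k0 None)%:E
     + \sum_(n < d | (0 < n)%N)
         \big[mine/+oo%E]_(i : 'I_N.+1 | `[< Iset n i >])
            (sexp lam t s n (Some i))%:E)%E.
Proof.
move=> k00; rewrite /Sunder (bigD1 k0)//=; congr (_ + _)%E.
  have [j Ij] := Iset_exists lam t s k0.+1.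
  apply/eqP; rewrite eq_le; apply/andP; split; last first.
    apply/bigmin_geP; split=> [|i /asboolP Ii]; first exact: leey.
    by rewrite ratio_qnat// /natexp k00.
  have <- : Defs.ratio lam t q s k0 j = sexp lam t s k0 None.
    by rewrite ratio_qnat// /natexp k00.
  by apply: (bigmin_le_cond _ (fun i => (Defs.ratio lam t q s k0 i)%:E)); exact/asboolP.
apply: eq_big => [n|n n0].
  by rewrite lt0n -k00.
have {}n0 : (0 < n)%N by rewrite lt0n -k00; exact: n0.
apply/eqP; rewrite eq_le; apply/andP; split; apply/bigmin_geP; split=> [|i /asboolP Ii];
  try exact: leey.
  have Ii' : Iset n.+1 i by apply: Iset_le Ii => //; exact: ltn_ord.
  rewrite -natexp_Some// -ratio_qnat//.
  by apply: (bigmin_le_cond _ (fun i => (Defs.ratio lam t q s n i)%:E)); exact/asboolP.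
rewrite ratio_qnat// /natexp gtn_eqF//.
apply: (bigmin_le_cond _ (fun i => (sexp lam t s n (Some i))%:E)).
by apply/asboolP; exact: Iset_projidx.
Qed.

End NaturalMeasure.

(** * Assouad and lower dimensions *)

Lemma powR_expR (R : realType) (a x : R) : 0 < a -> powR a x = expR (x * ln a).
Proof. by move=> a0; rewrite /powR gt_eqF. Qed.

(** Divide by [tau] and let it tend to infinity. In use, [tau] is the logarithm of a ratio of scales
    and [c] a bounded error. *)
Lemma le_of_affine (R : realType) (a b c t0 : R) :
  (forall tau, t0 < tau -> tau * a <= tau * b + c) -> a <= b.
Proof.
move=> h; rewrite leNgt; apply/negP => ba.
pose tau := `|t0| + (`|c| + 1) / (a - b).
have ab : 0 < a - b by rewrite subr_gt0.
have c1 : 0 < (`|c| + 1) / (a - b) by rewrite divr_gt0// ltr_wpDl.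
have := h tau; rewrite (le_lt_trans (ler_norm t0)) ?ltrDl// => /(_ isT).
rewrite -lerBlDl -mulrBr /tau mulrDl divfK ?gt_eqF// => h1.
have : 0 <= `|t0| * (a - b) by rewrite mulr_ge0// ltW.
have := ler_norm c; lra.
Qed.

Lemma ler_div2 (R : realType) (a b c e : R) :
  0 <= a -> 0 < e -> a <= c -> e <= b -> a / b <= c / e.
Proof.
move=> a0 e0 ac eb; have b0 := lt_le_trans e0 eb.
by apply: ler_pM => //; rewrite ?invr_ge0 ?(ltW b0)// lef_pV2 ?posrE.
Qed.

Section Dimensions.
Variables (R : realType) (d N : nat) (lam t : 'I_N.+1 -> 'I_d -> R).
Variables (p : 'I_N.+1 -> R) (mu : probability (SigmaM N) R).
Hypothesis d0 : (0 < d)%N.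
Hypothesis lam01 : forall i n, 0 < lam i n < 1.
Hypothesis fcube : forall i x, unit_cube x -> unit_cube (ifs_map lam t i x).
Hypothesis finj : forall i j, i != j ->
     ~ (forall x, unit_cube x -> ifs_map lam t i x = ifs_map lam t j x).
Hypothesis sppc : very_strong_SPPC lam t.
Hypothesis p0 : forall i, 0 < p i.
Hypothesis p1 : \sum_i p i = 1.
Hypothesis bern : is_bernoulli p mu.
Implicit Types (v w : Sigma N) (r : R) (x : 'I_d -> R).

Local Notation mass w r := (fine (mu (acube lam t w (stopL lam w r)))).
Local Notation nu := (Defs.nu lam t mu).
Local Notation coding := (coding lam t).
Local Notation dyad := (dyad R).

Let d1 : 1 <= d%:R :> R.
Proof. by rewrite ler1n. Qed.

Lemma nu_le1 x r : nu (cball x r) <= 1.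
Proof.
rewrite /Defs.nu -[leRHS]/(fine 1%E) -(probability_setT mu).
by apply: fine_mu_le => //; exact: cball_measurable.
Qed.

Lemma nu_cball_mono x r r' : r <= r' -> nu (cball x r) <= nu (cball x r').
Proof.
move=> rr'; apply: fine_mu_le; try exact: cball_measurable.
by move=> v /=; rewrite /cball/= => h; exact: le_trans rr'.
Qed.

Lemma mass_le_cball x w (e rho r : R) : 0 < rho ->
  Defs.edist x (coding w) <= e -> d%:R * (rho + e) <= r ->
  mass w rho <= nu (cball x r).
Proof.
move=> rho0 xe hr; apply: fine_mu_le; first exact: acube_measurable.
  exact: cball_measurable.
move=> v hv; rewrite /= /cball/=; apply: le_trans hr; apply: edist_le_coord => k.
have h1 := acube_coding lam01 fcube rho0 hv k.
have h2 := le_trans (le_coord_edist x (coding w) k) xe.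
rewrite (_ : x k - coding v k = - (coding v k - coding w k) + (x k - coding w k));
  last by ring.
by rewrite (le_trans (ler_normD _ _))// normrN lerD.
Qed.

Lemma nu_cball_gt0 x r : supp lam t mu x -> 0 < r -> 0 < nu (cball x r).
Proof.
move=> sx r0; apply: lt_le_trans (sx r r0) _.
apply: fine_mu_le; [exact: oball_measurable|exact: cball_measurable|].
by move=> v /=; rewrite /oball /cball/= => /ltW.
Qed.

Lemma supp_edist_le c x y :
  (forall w u k, `|coding w k - coding u k| <= c) ->
  supp lam t mu x -> supp lam t mu y -> Defs.edist x y <= d%:R * c.
Proof.
move=> hc sx sy; apply: edist_le_coord => k.
apply/ler_addgt0Pr => e e0.
have e20 : 0 < e / 2 by rewrite divr_gt0.
have [w hw] := supp_approx sx e20; have [u hu] := supp_approx sy e20.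
have h1 := le_trans (le_coord_edist x (coding w) k) (ltW hw).
have h2 := le_trans (le_coord_edist y (coding u) k) (ltW hu).
move: h1 h2 (hc w u k); rewrite !ler_norml => /andP[a1 a2] /andP[b1 b2] /andP[c1 c2].
apply/andP; split; lra.
Qed.

Let dists : set R := [set Defs.edist xy.1 xy.2 | xy in
  supp lam t mu `*` supp lam t mu].

Lemma dists_ubound c : (forall w u k, `|coding w k - coding u k| <= c) ->
  ubound dists (d%:R * c).
Proof. by move=> hc _ [[x y] [/= sx sy] <-]; exact: supp_edist_le. Qed.

Lemma coding_dist_le1 w u k : `|coding w k - coding u k| <= 1.
Proof. by rewrite -(prodL0 lam u k); apply: coding_near. Qed.

Lemma diam_supp_le c : (forall w u k, `|coding w k - coding u k| <= c) ->
  diam (supp lam t mu) <= d%:R * c.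
Proof.
move=> hc; apply: ge_sup; last exact: dists_ubound.
pose x := coding (fun=> ord0).
exists (Defs.edist x x), (x, x) => //=.
by split=> /=; exact: (coding_supp lam01 fcube p0 bern).
Qed.

Lemma le_diam_supp x y : supp lam t mu x -> supp lam t mu y ->
  Defs.edist x y <= diam (supp lam t mu).
Proof.
move=> sx sy; apply: ub_le_sup; first by exists (d%:R * 1); apply: dists_ubound; exact: coding_dist_le1.
by exists (x, y).
Qed.

Lemma edist_self x : Defs.edist x x <= 0.
Proof.
by rewrite -(mulr0 d%:R); apply: edist_le_coord => k; rewrite subrr normr0.
Qed.

(** * Comparison of balls with approximate cubes *)

Section Separation.
Variable dl : R.
Hypothesis dl01 : 0 < dl <= 1.
Hypothesis sep : forall (s : 'S_d) v w r, inA lam s -> 0 < r ->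
  compat s (stopL lam w r) -> ~ acube lam t w (stopL lam w r) v ->
  exists k, dl * r < `|coding v k - coding w k|.

Let dl0 : 0 < dl.
Proof. by case/andP: dl01. Qed.

Lemma cball_le_mass x w (e rho r : R) : 0 < rho ->
  Defs.edist x (coding w) <= e -> r + e <= dl * rho ->
  nu (cball x r) <= mass w rho.
Proof.
move=> rho0 xe hr; apply: fine_mu_le; [exact: cball_measurable|exact: acube_measurable|].
move=> v; rewrite /= /cball/= => xv; apply: contrapT => nv.
have [s [sA sc]] := compat_exists lam01 w rho0.
have [k hk] := sep sA rho0 sc nv.
have h1 := le_trans (le_coord_edist x (coding v) k) xv.
have h2 := le_trans (le_coord_edist x (coding w) k) xe.
move: hk; rewrite ltNge => /negP; apply; apply: le_trans hr.
rewrite (_ : coding v k - coding w k = - (x k - coding v k) + (x k - coding w k));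
  last by ring.
by rewrite (le_trans (ler_normD _ _))// normrN lerD.
Qed.

(** Two constant words with distinct letters are separated at scale 1/2, where the first letter is
    prescribed in every coordinate. *)
Lemma diam_supp_gt0 : (0 < N)%N -> 0 < diam (supp lam t mu).
Proof.
move=> N0; pose w : Sigma N := fun=> ord0; pose v : Sigma N := fun=> ord_max.
have h01 : 0 < (2^-1 : R) < 1 by rewrite invr_gt0 ltr0n/= invf_lt1// ltr1n.
have h0 : 0 < (2^-1 : R) by case/andP: h01.
have [s [sA sc]] := compat_exists lam01 w h0.
have [|k hk] := sep (v := v) sA h0 sc.
  move=> hv; apply: (@finj ord_max ord0); first by rewrite -val_eqE/= -lt0n.
  move=> x _; apply/funext => k.
  have /andP[/eqP e1 /eqP e2] : agree lam t k ord_max ord0.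
    by apply: (hv 0%N k); rewrite lt_stopL// prodL0; case/andP: h01.
  by rewrite /ifs_map e1 e2.
apply: (@lt_le_trans _ _ (Defs.edist (coding v) (coding w))).
  apply: lt_le_trans (le_coord_edist _ _ k); apply: lt_trans hk.
  by rewrite mulr_gt0.
by apply: le_diam_supp; exact: (coding_supp lam01 fcube p0 bern).
Qed.

(** The cube of size [rho] lies in the ball once [d * (rho + e) <= r], so [rho] and [e] may both be
    [r / (2 * d)]; rounding [rho] down to a dyadic scale costs a factor 2. *)
Lemma lower_scale r : 0 < r <= d%:R -> exists j,
  [/\ r / (4 * d%:R) <= dyad j, dyad j <= r / (2 * d%:R) &
   forall x w, Defs.edist x (coding w) <= r / (2 * d%:R) ->
     mass w (dyad j) <= nu (cball x r)].
Proof.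
move=> /andP[r0 rd].
have dp : 0 < d%:R :> R by rewrite ltr0n.
have y01 : 0 < r / (2 * d%:R) <= 1.
  rewrite divr_gt0 ?mulr_gt0//= ler_pdivrMr ?mulr_gt0// mul1r.
  by rewrite (le_trans rd)// ler_peMl ?ler1n// ltW.
have [j /andP[j1 j2]] := dyad_between y01.
exists j.+1; split; last first.
- move=> x w xw; apply: (mass_le_cball (dyad_gt0 R j.+1) xw).
  apply: (@le_trans _ _ (d%:R * (r / (2 * d%:R) + r / (2 * d%:R)))).
    by rewrite ler_wpM2l ?ler0n// lerD2r ltW.
  rewrite le_eqVlt; apply/orP; left; apply/eqP; field.
  by rewrite gt_eqF.
- exact: ltW.
rewrite dyadS (_ : r / (4 * d%:R) = r / (2 * d%:R) / 2) ?ler_pM2r ?invr_gt0//.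
by field; rewrite gt_eqF.
Qed.

(** With a centre error of at most [r] the ball lies in the cube of size [2 * r / dl], rounded up to
    a dyadic scale. If this size exceeds 1, the scale 1 serves, where the cube has full mass; hence
    the minimum. *)
Lemma upper_scale r : 0 < r -> exists j,
  [/\ dyad j <= 4 * r / dl, Num.min 1 (2 * r / dl) <= dyad j &
   forall x w, Defs.edist x (coding w) <= r ->
     nu (cball x r) <= mass w (dyad j)].
Proof.
move=> r0; have y0 : 0 < 2 * r / dl by rewrite divr_gt0// mulr_gt0.
have E4 : 4 * r / dl = 2 * (2 * r / dl) by field; rewrite gt_eqF.
have [y1|y1] := leP (2 * r / dl) 1; last first.
  exists 0%N; have -> : dyad 0 = 1 by exact: expr0.
  split; first by rewrite E4; lra.
    exact: lexx.
  by move=> x w _; rewrite (mass_ge1 t lam01 bern)// nu_le1.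
have [|j /andP[j1 j2]] := @dyad_between R (2 * r / dl); first by rewrite y0.
exists j; split; first by rewrite E4; move: j1; rewrite dyadS; lra.
  by rewrite j2.
move=> x w xw; apply: (cball_le_mass (dyad_gt0 R j) xw).
by move: j2; rewrite ler_pdivrMr// => j2; rewrite mulrC; lra.
Qed.

Lemma expR_nln_mass w r r' :
  mass w r' / mass w r = expR (- ln (mass w r) - - ln (mass w r')).
Proof.
have h := mass_gt0 lam t p0 bern w r; have h' := mass_gt0 lam t p0 bern w r'.
by rewrite opprK addrC expRD expRN !lnK ?posrE.
Qed.

Lemma assouad_le (S : R) : 0 <= S ->
  (forall s, inA lam s -> (Sbar lam t p s <= S%:E)%E) ->
  (assouad_dim lam t mu <= S%:E)%E.
Proof.
move=> S0 hS; have [C hC] := growth_upper lam01 finj p0 p1 bern S0 hS.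
apply: ereal_inf_lbound; exists S => //; split=> //.
(* The product of the two losses of scale, [4 / dl] for the outer cube and [4 * d] for the inner
   one. *)
pose B := ln (16 * d%:R / dl).
have dp : 0 < d%:R :> R by rewrite ltr0n.
exists (expR (C + S * B)); split; first exact: expR_gt0.
move=> x r r' sx r0 rr' rdiam; have r'0 := lt_trans r0 rr'.
have := ltW (lt_le_trans rdiam (diam_supp_le coding_dist_le1)).
rewrite mulr1 => r'd.
have [|j [j1 j2 hj]] := @lower_scale r; first by rewrite r0 (le_trans (ltW rr')).
have [j' [j1' j2' hj']] := upper_scale r'0.
have e0 : 0 < r / (2 * d%:R) by rewrite divr_gt0// mulr_gt0.
have er : r / (2 * d%:R) <= r.
  rewrite ler_pdivrMr ?mulr_gt0//; have := ler_peMr (ltW r0) d1; lra.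
have [w /ltW xw] := supp_approx sx e0.
have m1 := hj x w xw.
have m2 : nu (cball x r') <= mass w (dyad j').
  by apply: hj'; rewrite (le_trans xw)// (le_trans er)// ltW.
have jj : (j' <= j)%N.
  rewrite -(le_dyad R); apply: le_trans (le_trans j2 _) j2'.
  have dl1 : dl <= 1 by case/andP: dl01.
  rewrite le_min ler_pdivrMr ?mulr_gt0// mul1r; apply/andP; split; first by lra.
  apply: (le_trans er); rewrite ler_pdivlMr//.
  have := ler_piMr (ltW r0) dl1; lra.
have mp := mass_gt0 lam t p0 bern w (dyad j).
apply: (@le_trans _ _ (mass w (dyad j') / mass w (dyad j))).
  by apply: ler_div2 => //; exact: ltW (nu_cball_gt0 sx r'0).
rewrite expR_nln_mass powR_expR ?divr_gt0// -expRD ler_expR.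
apply: (le_trans (hC w j' j jj)).
rewrite addrC -addrA lerD2l -mulrDr ler_wpM2l//.
rewrite /B -lnM ?posrE ?divr_gt0 ?mulr_gt0//.
rewrite ler_ln ?posrE ?mulr_gt0 ?invr_gt0 ?dyad_gt0//.
rewrite ler_pdivrMr ?dyad_gt0//; apply: (le_trans j1').
apply: (@le_trans _ _ (16 * d%:R / dl * (r' / r) * (r / (4 * d%:R)))).
  rewrite le_eqVlt; apply/orP; left; apply/eqP; field.
  by rewrite !gt_eqF.
by rewrite ler_wpM2l// ltW// mulr_gt0 ?divr_gt0 ?mulr_gt0.
Qed.

Lemma lower_ge (S : R) : 0 <= S -> diam (supp lam t mu) != 0 ->
  (forall s, inA lam s -> (S%:E <= Sunder lam t p s)%E) ->
  (S%:E <= lower_dim lam t mu)%E.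
Proof.
move=> S0 dn0 hS; have [C hC] := growth_lower lam01 finj p0 p1 bern S0 hS.
rewrite /lower_dim (negbTE dn0).
apply: ereal_sup_ubound; exists S => //; split=> //.
pose B := ln (16 * d%:R / dl).
have dp : 0 < d%:R :> R by rewrite ltr0n.
exists (expR (- `|C| - S * B)); split; first exact: expR_gt0.
move=> x r r' sx r0 rr' rdiam; have r'0 := lt_trans r0 rr'.
have := ltW (lt_le_trans rdiam (diam_supp_le coding_dist_le1)).
rewrite mulr1 => r'd.
have [|j' [j1' j2' hj']] := @lower_scale r'; first by rewrite r'0.
have [j [j1 j2 hj]] := upper_scale r0.
have e0 : 0 < r / (2 * d%:R) by rewrite divr_gt0// mulr_gt0.
have er : r / (2 * d%:R) <= r.
  rewrite ler_pdivrMr ?mulr_gt0//; have := ler_peMr (ltW r0) d1; lra.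
have er' : r / (2 * d%:R) <= r' / (2 * d%:R).
  by rewrite ler_pM2r ?invr_gt0 ?mulr_gt0// ltW.
have [w /ltW xw] := supp_approx sx e0.
have m1 : mass w (dyad j') <= nu (cball x r') by apply: hj'; exact: le_trans er'.
have m2 : nu (cball x r) <= mass w (dyad j) by apply: hj; exact: le_trans er.
have mp := mass_gt0 lam t p0 bern w (dyad j').
have mp' := mass_gt0 lam t p0 bern w (dyad j).
have np := nu_cball_gt0 sx r0; have np' := nu_cball_gt0 sx r'0.
have hB : ln (r' / r) - B <= ln (dyad j' / dyad j).
  rewrite lerBlDl /B -lnM ?posrE ?divr_gt0 ?mulr_gt0 ?dyad_gt0//.
  rewrite ler_ln ?posrE ?mulr_gt0 ?divr_gt0 ?mulr_gt0 ?invr_gt0 ?dyad_gt0//.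
  rewrite mulrA ler_pdivlMr ?dyad_gt0//.
  apply: (@le_trans _ _ (r' / r * (4 * r / dl))).
    by rewrite ler_wpM2l// ltW// divr_gt0.
  apply: (@le_trans _ _ (16 * d%:R / dl * (r' / (4 * d%:R)))).
    by rewrite le_eqVlt; apply/orP; left; apply/eqP; field; rewrite !gt_eqF.
  by rewrite ler_wpM2l// ltW// divr_gt0 ?mulr_gt0.
rewrite powR_expR ?divr_gt0// -expRD.
(* If the cubes come in the wrong order, then [ln (r' / r) <= B] and monotonicity of the measure
   suffices. *)
have [jj|jj] := leqP j' j.
  apply: (@le_trans _ _ (mass w (dyad j') / mass w (dyad j))); last first.
    by apply: ler_div2 => //; exact: ltW.
  rewrite expR_nln_mass ler_expR; apply: le_trans (hC w j' j jj).
  have : S * (ln (r' / r) - B) <= S * ln (dyad j' / dyad j) by rewrite ler_wpM2l.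
  have := ler_norm C; rewrite mulrBr; lra.
apply: (@le_trans _ _ 1); last by rewrite ler_pdivlMr// mul1r nu_cball_mono// ltW.
rewrite -expR0 ler_expR.
have : ln (dyad j' / dyad j) <= 0.
  by rewrite ln_le0// ler_pdivrMr ?dyad_gt0// mul1r le_dyad ltnW.
move=> h; have : S * (ln (r' / r) - B) <= 0 by rewrite mulr_ge0_le0//; lra.
rewrite mulrBr; have := normr_ge0 C; lra.
Qed.

(** Inside a window every letter costs exactly the cost of [f n]. The constant pays for at most [D]
    stray letters at each end and for the rounding of the block length; that it does not involve
    [tau] is the point. *)
Lemma inB_growth s (f : 'I_d -> 'I_N.+1) : inB lam s ->
  (forall n : 'I_d, Iset lam t s n.+1 (f n)) ->
  exists C : R, forall tau X : R, 0 < tau -> exists w r r',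
  [/\ 0 < r < r', r' <= expR (- X), ln (r' / r) = tau &
   `|(- ln (mass w r) - - ln (mass w r')) -
     tau * \sum_n Defs.ratio lam t p s n (f n)| <= C].
Proof.
move=> sB fI; have [D hD] := windows lam01 d0 sB.
have [pm pm0 hp] := fin_family_lbound p0.
exists (\sum_n (D%:R * - ln pm + D%:R * Defs.ratio lam t p s n (f n))).
move=> tau X tau0.
have [w [r [r' [a [K [/andP[r0 rr'] r'X lrr ord H]]]]]] := hD f tau X tau0.
exists w, r, r'; split=> //; first by rewrite r0.
have cr : compat s (stopL lam w r) by move=> b c /ord[_ /ltnW].
have cr' : compat s (stopL lam w r') by move=> b c /ord[/ltnW].
rewrite (nln_mass_diff t lam01 p0 p1 bern r0 (ltW rr') cr cr').
rewrite mulr_sumr -sumrB; apply: le_trans (ler_norm_sum _ _ _) _.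
apply: ler_sum => n _; have [wx /andP[a1 a2] /andP[b1 b2] hK] := H n.
pose cst l := cond_cost lam t p s n (w l).
have cst0 l : 0 <= cst l by exact: cost_ge0.
have cstM l : cst l <= - ln pm by exact: cost_le.
have Sbd l m : (l <= m <= l + D)%N -> 0 <= \sum_(l <= j < m) cst j <= D%:R * - ln pm.
  move=> /andP[lm mD]; rewrite sumr_ge0//=.
  apply: (@le_trans _ _ (\sum_(l <= j < m) - ln pm)); first exact: ler_sum.
  rewrite sumr_const_nat -[X in X <= _]mulr_natl ler_wpM2r ?(le_trans (cst0 0%N))//.
  by rewrite ler_nat leq_subLR.
have LL := le_stopL lam01 w (s n) r0 (ltW rr').
have e1 := Sbd _ _ (introT andP (conj a1 a2)).
have e2 := Sbd _ _ (introT andP (conj b1 b2)).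
have e3 : \sum_(stopL lam w r' (s n) <= j < a n + K n) cst j =
    \sum_(stopL lam w r' (s n) <= j < stopL lam w r (s n)) cst j +
    \sum_(stopL lam w r (s n) <= j < a n + K n) cst j.
  by rewrite -big_cat_nat.
have e4 : \sum_(stopL lam w r' (s n) <= j < a n + K n) cst j =
    \sum_(stopL lam w r' (s n) <= j < a n) cst j +
    (K n)%:R * cond_cost lam t p s n (f n).
  rewrite (big_cat_nat a1 (leq_addr _ _))/=; congr (_ + _).
  rewrite (eq_big_nat _ _ (F2 := fun=> cond_cost lam t p s n (f n))); last first.
    by move=> j /wx wj; rewrite /cst wj.
  by rewrite sumr_const_nat addKn mulr_natl.
have rt0 := ratio_ge0 finj p0 p1 lam01 (fI n).
have e5 := cost_ratio finj p1 lam01 (fI n).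
have e6 : (K n)%:R * cond_cost lam t p s n (f n) - tau * Defs.ratio lam t p s n (f n) =
    Defs.ratio lam t p s n (f n) * ((K n)%:R * - ln (lam (f n) (s n)) - tau).
  by rewrite e5; ring.
have e7 : `|(K n)%:R * cond_cost lam t p s n (f n) - tau * Defs.ratio lam t p s n (f n)|
    <= D%:R * Defs.ratio lam t p s n (f n).
  by rewrite e6 normrM (ger0_norm rt0) mulrC ler_wpM2r.
rewrite -[X in `|X - _|]/(\sum_(stopL lam w r' (s n) <= j < stopL lam w r (s n)) cst j).
move: e1 e2 e3 e4 e7; rewrite !ler_norml.
by move=> /andP[? ?] /andP[? ?] ? ? /andP[? ?]; apply/andP; split; lra.
Qed.

Lemma Sbar_le_assouad s : (0 < N)%N -> inB lam s ->
  (Sbar lam t p s <= assouad_dim lam t mu)%E.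
Proof.
move=> N0 sB; have [f [fI -> _]] := SbarP lam t s p.
have [C hC] := inB_growth sB fI; set F := \sum_n _ in hC *.
apply: le_ereal_inf_tmp => _ [S [S0 [C0 [C00 hS]]] <-]; rewrite lee_fin.
have dm := diam_supp_gt0 N0.
have dp : 0 < d%:R :> R by rewrite ltr0n.
(* The test radii are [d * r'], whose ball contains the cube of size [r'], and [dl * r], whose ball
   lies in the cube of size [r]. The value passed for [X] keeps [d * r'] below the diameter. *)
apply: (@le_of_affine _ _ _ (C + ln C0 + S * ln (d%:R / dl)) 0) => tau tau0.
have [w [r [r' [/andP[r0 rr'] r'X lrr hF]]]] :=
  hC tau (- ln (diam (supp lam t mu) / (2 * d%:R))) tau0.
have r'0 := lt_trans r0 rr'.
rewrite opprK lnK ?posrE ?divr_gt0 ?mulr_gt0// in r'X.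
pose x := coding w.
have sx : supp lam t mu x by exact: (coding_supp lam01 fcube p0 bern).
have rl : 0 < dl * r by rewrite mulr_gt0.
have rlr : dl * r < d%:R * r'.
  apply: (@le_lt_trans _ _ (1 * r)); first by rewrite ler_pM2r//; case/andP: dl01.
  by apply: (@lt_le_trans _ _ (1 * r')); rewrite ?mul1r// ler_peMl// ltW.
have rd : d%:R * r' < diam (supp lam t mu).
  rewrite mulrC -ltr_pdivlMr//; apply: (le_lt_trans r'X).
  by rewrite ltr_pM2l// ltf_pV2 ?posrE ?mulr_gt0//; lra.
have := hS x _ _ sx rl rlr rd.
have m1 : mass w r' <= nu (cball x (d%:R * r')).
  by apply: (mass_le_cball r'0 (edist_self x)); rewrite addr0.
have m2 : nu (cball x (dl * r)) <= mass w r.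
  by apply: (cball_le_mass r0 (edist_self x)); rewrite addr0.
have mp := mass_gt0 lam t p0 bern w r; have mp' := mass_gt0 lam t p0 bern w r'.
have np := nu_cball_gt0 sx rl.
move=> h; have {h m1 m2} : mass w r' / mass w r <= C0 * powR (d%:R * r' / (dl * r)) S.
  by apply: le_trans h; apply: ler_div2 => //; exact: ltW.
rewrite expR_nln_mass powR_expR ?divr_gt0 ?mulr_gt0// -[X in _ <= X * _]lnK ?posrE// -expRD ler_expR.
have -> : d%:R * r' / (dl * r) = (d%:R / dl) * (r' / r).
  by field; rewrite !gt_eqF.
rewrite lnM ?posrE ?divr_gt0// lrr mulrDr; move: hF; rewrite ler_norml; lra.
Qed.

Lemma lower_le_Sunder s : (0 < N)%N -> inB lam s ->
  (lower_dim lam t mu <= Sunder lam t p s)%E.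
Proof.
move=> N0 sB; have [f [fI -> _]] := SunderP lam t s p.
have [C hC] := inB_growth sB fI; set F := \sum_n _ in hC *.
have dm := diam_supp_gt0 N0; rewrite /lower_dim gt_eqF//.
apply: ge_ereal_sup => _ [S [S0 [C0 [C00 hS]]] <-]; rewrite lee_fin.
have dp : 0 < d%:R :> R by rewrite ltr0n.
(* The roles are exchanged: the radii are now [dl * r'] and [d * r]. They are in the right order
   only once [tau] exceeds [ln (d / dl)], hence the threshold. *)
apply: (@le_of_affine _ _ _ (C - ln C0 + S * ln (d%:R / dl)) (`|ln (d%:R / dl)|)) => tau taub.
have tau0 : 0 < tau by apply: le_lt_trans taub.
have [w [r [r' [/andP[r0 rr'] r'X lrr hF]]]] :=
  hC tau (- ln (diam (supp lam t mu) / 2)) tau0.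
have r'0 := lt_trans r0 rr'.
rewrite opprK lnK ?posrE ?divr_gt0// in r'X.
pose x := coding w.
have sx : supp lam t mu x by exact: (coding_supp lam01 fcube p0 bern).
have rl : 0 < d%:R * r by rewrite mulr_gt0.
have rlr : d%:R * r < dl * r'.
  have : d%:R / dl < r' / r.
    rewrite -ltr_ln ?posrE ?divr_gt0// lrr.
    by apply: le_lt_trans taub; exact: ler_norm.
  by rewrite ltr_pdivrMr// mulrAC ltr_pdivlMr// [r' * _]mulrC.
have rd : dl * r' < diam (supp lam t mu).
  apply: (@le_lt_trans _ _ (1 * r')); first by rewrite ler_pM2r//; case/andP: dl01.
  by rewrite mul1r (le_lt_trans r'X)//; lra.
have := hS x _ _ sx rl rlr rd.
have m1 : mass w r <= nu (cball x (d%:R * r)).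
  by apply: (mass_le_cball r0 (edist_self x)); rewrite addr0.
have m2 : nu (cball x (dl * r')) <= mass w r'.
  by apply: (cball_le_mass r'0 (edist_self x)); rewrite addr0.
have mp := mass_gt0 lam t p0 bern w r; have mp' := mass_gt0 lam t p0 bern w r'.
have np := nu_cball_gt0 sx rl.
move=> h; have {h m1 m2} : C0 * powR (dl * r' / (d%:R * r)) S <= mass w r' / mass w r.
  apply: (le_trans h); apply: ler_div2 => //.
  by apply: ltW; apply: nu_cball_gt0 => //; rewrite mulr_gt0.
have C0E : expR (ln C0) = C0 by rewrite lnK ?posrE.
rewrite expR_nln_mass powR_expR ?divr_gt0 ?mulr_gt0// -{1}C0E -expRD ler_expR.
have -> : dl * r' / (d%:R * r) = (r' / r) / (d%:R / dl).
  by field; rewrite !gt_eqF.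
rewrite [ln (_ / (d%:R / dl))]ln_div ?posrE ?divr_gt0// lrr mulrBr.
move: hF; rewrite ler_norml; lra.
Qed.

End Separation.

(** With a single map all conditional masses are 1. Both sums then vanish, in accordance with a
    support reduced to a point. *)
Lemma ratio_singleton s (n : 'I_d) i : N = 0%N -> Iset lam t s n.+1 i ->
  Defs.ratio lam t p s n i = 0.
Proof.
move=> N0 Ii; have pi j : p j = 1.
  rewrite -p1 (bigD1 j)//= big1 ?addr0// => j' /eqP[]; apply: val_inj => /=.
  by have := ltn_ord j'; have := ltn_ord j; rewrite {2 4}N0 !ltnS !leqn0 => /eqP-> /eqP->.
have cm m : class_mass lam t p s m i = 1.
  apply/eqP; rewrite eq_le (cmass_le1 lam t s p0 p1)/=.
  by rewrite -{1}(pi i) (cmass_ge lam t s p0).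
have := cost_ratio finj p1 lam01 Ii; rewrite /cond_cost !cm divr1 ln1 oppr0.
by move=> /esym/eqP; rewrite mulf_eq0 (gt_eqF (nln_lam_gt0 lam01 i (s n))) orbF => /eqP.
Qed.

Lemma diam_singleton : N = 0%N -> diam (supp lam t mu) = 0.
Proof.
move=> N0; apply/eqP; rewrite eq_le; apply/andP; split.
  rewrite -(mulr0 d%:R); apply: diam_supp_le => w u k.
  suff -> : w = u by rewrite subrr normr0.
  apply/funext => l; apply: val_inj => /=.
  by have := ltn_ord (w l); have := ltn_ord (u l);
    rewrite {2 4}N0 !ltnS !leqn0 => /eqP-> /eqP->.
have sx := coding_supp lam01 fcube p0 bern (fun=> ord0).
by apply: le_trans (le_diam_supp sx sx); rewrite /Defs.edist sqrtr_ge0.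
Qed.

Lemma inA_exists : exists s, inA lam s.
Proof.
have [s [sA _]] := compat_exists lam01 (fun=> ord0) (ltr01 : 0 < 1 :> R).
by exists s.
Qed.

Lemma Sbar_real s : exists2 S : R, 0 <= S & Sbar lam t p s = S%:E /\ (N = 0%N -> S = 0).
Proof.
have [f [fI -> _]] := SbarP lam t s p.
exists (\sum_n Defs.ratio lam t p s n (f n)).
  by apply: sumr_ge0 => n _; exact: (ratio_ge0 finj p0 p1 lam01 (fI n)).
by split=> // N0; apply: big1 => n _; exact: ratio_singleton.
Qed.

Lemma Sunder_real s : exists2 S : R, 0 <= S & Sunder lam t p s = S%:E /\ (N = 0%N -> S = 0).
Proof.
have [f [fI -> _]] := SunderP lam t s p.
exists (\sum_n Defs.ratio lam t p s n (f n)).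
  by apply: sumr_ge0 => n _; exact: (ratio_ge0 finj p0 p1 lam01 (fI n)).
by split=> // N0; apply: big1 => n _; exact: ratio_singleton.
Qed.

Lemma dimension_bounds :
  [/\ (\big[maxe/-oo%E]_(s : 'S_d | `[< inB lam s >]) Sbar lam t p s
         <= assouad_dim lam t mu)%E,
      (assouad_dim lam t mu
         <= \big[maxe/-oo%E]_(s : 'S_d | `[< inA lam s >]) Sbar lam t p s)%E,
      (\big[mine/+oo%E]_(s : 'S_d | `[< inA lam s >]) Sunder lam t p s
         <= lower_dim lam t mu)%E
    & (lower_dim lam t mu
         <= \big[mine/+oo%E]_(s : 'S_d | `[< inB lam s >]) Sunder lam t p s)%E].
Proof.
have [dl dl01 sep] := acube_separation lam01 fcube sppc.
have [sA hsA] := inA_exists.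
have diam0 : (0 < N)%N = false -> N = 0%N by case: (N).
split.
- apply/bigmax_leP; split=> [|s /asboolP sB]; first exact: leNye.
  case N0 : (0 < N)%N; first exact: (Sbar_le_assouad dl01 sep).
  have [S _ [-> /(_ (diam0 N0)) ->]] := Sbar_real s.
  by apply: le_ereal_inf_tmp => _ [S' [S'0 _] <-]; rewrite lee_fin.
- have [||s1 h1 h2] := @eq_bigmax _ _ _ -oo%E sA (fun s => `[< inA lam s >])
    (fun s => Sbar lam t p s).
  + exact/asboolP.
  + by move=> i _; rewrite leNye.
  rewrite h2; have [S S0 [SE _]] := Sbar_real s1; rewrite SE.
  apply: (assouad_le dl01 sep S0) => s hs; rewrite -SE -h2.
  by apply: (le_bigmax_cond _ (fun s => Sbar lam t p s)); exact/asboolP.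
- have [||s1 h1 h2] := @eq_bigmin _ _ _ +oo%E sA (fun s => `[< inA lam s >])
    (fun s => Sunder lam t p s).
  + exact/asboolP.
  + by move=> i _; rewrite leey.
  rewrite h2; have [S S0 [SE SN]] := Sunder_real s1; rewrite SE.
  have [dn|dn] := eqVneq (diam (supp lam t mu)) 0.
    (* Diameter 0 forces a single map; then the minimum is 0, and so is the lower dimension by
       convention. *)
    rewrite /lower_dim dn eqxx SN//; apply: diam0; apply/negP => N0.
    by have := diam_supp_gt0 dl01 sep N0; rewrite dn ltxx.
  apply: (lower_ge dl01 sep S0 dn) => s hs; rewrite -SE -h2.
  by apply: (bigmin_le_cond _ (fun s => Sunder lam t p s)); exact/asboolP.
- apply/bigmin_geP; split=> [|s /asboolP sB]; first exact: leey.
  case N0 : (0 < N)%N; first exact: (lower_le_Sunder dl01 sep).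
  have [S S0 [-> _]] := Sunder_real s.
  by rewrite /lower_dim (diam_singleton (diam0 N0)) eqxx lee_fin.
Qed.

End Dimensions.

Theorem theorem2p5 (R : realType) (d N : nat)
  (lam t : 'I_N.+1 -> 'I_d -> R) (p : 'I_N.+1 -> R)
  (mu : probability (SigmaM N) R) :
  (0 < d)%N ->
  (forall i n, 0 < lam i n < 1) ->
  (forall i x, unit_cube x -> unit_cube (ifs_map lam t i x)) ->
  (forall i j, i != j ->
     ~ (forall x, unit_cube x -> ifs_map lam t i x = ifs_map lam t j x)) ->
  (forall m n : 'I_d, m != n -> exists i, lam i n != lam i m) ->
  very_strong_SPPC lam t ->
  (forall i, 0 < p i) -> \sum_i p i = 1 ->
  is_bernoulli p mu ->
  [/\ (\big[maxe/-oo%E]_(sigma : 'S_d | `[< inB lam sigma >]) Sbar lam t p sigma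
         <= assouad_dim lam t mu)%E,
      (assouad_dim lam t mu
         <= \big[maxe/-oo%E]_(sigma : 'S_d | `[< inA lam sigma >]) Sbar lam t p sigma)%E,
      (\big[mine/+oo%E]_(sigma : 'S_d | `[< inA lam sigma >]) Sunder lam t p sigma
         <= lower_dim lam t mu)%E,
      (lower_dim lam t mu
         <= \big[mine/+oo%E]_(sigma : 'S_d | `[< inB lam sigma >]) Sunder lam t p sigma)%E
    & forall (sigma : 'S_d) (k0 : 'I_d), nat_of_ord k0 = 0%N ->
      Sbar lam t (qnat lam t sigma) sigma =
        ((sexp lam t sigma k0 None)%:E
         + \sum_(n < d | (0 < n)%N)
             \big[maxe/-oo%E]_(i : 'I_N.+1 | `[< Iset lam t sigma n i >])
                (sexp lam t sigma n (Some i))%:E)%E /\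
      Sunder lam t (qnat lam t sigma) sigma =
        ((sexp lam t sigma k0 None)%:E
         + \sum_(n < d | (0 < n)%N)
             \big[mine/+oo%E]_(i : 'I_N.+1 | `[< Iset lam t sigma n i >])
                (sexp lam t sigma n (Some i))%:E)%E].
Proof.
move=> d0 lam01 fcube finj _ sppc p0 p1 bern.
have [h1 h2 h3 h4] := dimension_bounds d0 lam01 fcube finj sppc p0 p1 bern.
split=> // s k0 k00; split; [exact: Sbar_qnat|exact: Sunder_qnat].
Qed.
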